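(* Consider a family, indexed by the number of qubits $n$ (asymptotics are as $n\to\infty$), of $t$-doped Clifford circuits $C_t$ on $n$ qubits with $t=O(\log_2 n)$, and bipartitions $E|F$ of the $n$ qubits with $t\le n_F$. Let $|\psi_t\rangle=C_t|0\rangle^{\otimes n}$, $\psi_E=\mathrm{tr}_F|\psi_t\rangle\langle\psi_t|$, let $W$ be the Clifford unitary and $\rho$ the $n$-qubit state defined in the context, let $\rho_E,\rho_F$ be the marginals of $\rho$, and let $X\in\{E,F\}$ be the subsystem whose marginal $\rho_X$ has the larger purity. Then there is a protocol which, given query access to the (unknown) circuit $C_t$, uses $\mathrm{poly}(n)$ queries and, except with negligibly small failure probability, determines $\mathrm{Pur}(\rho_X)$ exactly, and: (i) if $\mathrm{Pur}(\rho_X)=\Omega(1/\mathrm{poly}(n))$, then $\mathrm{Pur}(\psi_E)=\Omega(1/\mathrm{poly}(n))$, so that $\mathrm{Pur}(\psi_E)$ can be estimated by the swap test with a polynomial (in $n$) number of measurements, which is determined by $\mathrm{Pur}(\rho_X)$; (ii) if $\mathrm{Pur}(\rho_X)=\Theta(2^{-\alpha n})$ for some $\alpha>0$, then $$\mathrm{Pur}(\psi_E)=2^{-\alpha n+O(\log_2 n)} .$$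
   Context: The system consists of $n$ qubits, $\mathcal H=(\mathbb C^2)^{\otimes n}=\mathcal H_E\otimes\mathcal H_F$, where $E,F$ consist of $n_E,n_F$ qubits, $n=n_E+n_F$. The purity of a state $\sigma$ is $\mathrm{Pur}(\sigma)=\mathrm{tr}(\sigma^2)$. A $t$-doped Clifford circuit is a circuit of Clifford gates into which $t$ non-Clifford gates ($T$-gates) have been inserted. Known input (may be assumed): for $t\le n$, any $t$-doped Clifford circuit can be written $C_t=D^\dagger c_t D V$ with $D$ (the diagonalizer) and $V$ Clifford unitaries and $c_t$ a $t$-doped Clifford circuit acting nontrivially only on a subsystem of $t$ qubits; moreover such a $D$ can be learned (the ''Clifford Completion algorithm'') from $\mathrm{poly}(n)\exp(t)$ query accesses to the unknown $C_t$, with negligibly small failure probability. It is also known that an unknown stabilizer state (one given by a stabilizer group) can be learned from polynomially many copies, and that the purity of its marginals can be computed exactly and efficiently from its stabilizer group. The swap test estimates a purity to additive error $\epsilon$ with $O(\epsilon^{-2})$ measurements. Construction: choose a set $Y\subset F$ of $n_Y=t$ qubits and a permutation $\pi_Y$ of the $n$ qubits, with associated permutation unitary $T_{\pi_Y}$ (a Clifford operator), such that $c_t^Y:=T_{\pi_Y}c_tT_{\pi_Y}^\dagger$ acts nontrivially only on $Y$. Put $W:=T_{\pi_Y}D$, $d_Y=2^{n_Y}$, $\mathcal E(\cdot):=\mathrm{tr}_Y\big(W(\cdot)W^\dagger\big)$ and, with $\psi_t=|\psi_t\rangle\langle\psi_t|$, $$\rho:=W^\dagger\big(\mathcal E(\psi_t)\otimes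 d_Y^{-1}I_Y\big)W,\qquad \rho_E=\mathrm{tr}_F\rho,\quad \rho_F=\mathrm{tr}_E\rho .$$ *)

(* Defs.v *)
From HB Require Import structures.
From mathcomp Require Import all_boot all_order all_algebra all_fingroup.
From mathcomp Require Import all_classical all_reals all_analysis.
From mathcomp Require Import complex.
Set Implicit Arguments.
Unset Strict Implicit.
Unset Printing Implicit Defensive.
Import Order.TTheory GRing.Theory Num.Theory numFieldNormedType.Exports.
Local Open Scope classical_set_scope.
Local Open Scope sesquilinear_scope.
Local Open Scope ring_scope.

(* A register is a finite type Q of qubits; computational basis states are the
   bit assignments Q -> bool.  Operators are MathComp matrices whose rows and
   columns are numbered through enum_rank; [mkop] and [ent] build and read an
   operator by its entries <x|A|y>. *)
Definition bits (Q : finType) : finType := {ffun Q -> bool}.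

Definition op (R : realType) (Q : finType) : Type := 'M[R[i]]_#|bits Q|.

Definition mkop (R : realType) (Q : finType) (f : bits Q -> bits Q -> R[i]) :
    op R Q :=
  \matrix_(i, j) f (enum_val i) (enum_val j).

Definition ent (R : realType) (Q : finType) (A : op R Q) (x y : bits Q) :
    R[i] :=
  A (enum_rank x) (enum_rank y).

Definition retr (R : realType) (Q : finType) (A : op R Q) : R :=
  complex.Re (\tr A).

Definition conj_by (R : realType) (Q : finType) (U A : op R Q) : op R Q :=
  U *m A *m U^t*.

Definition ket0 (R : realType) (Q : finType) : op R Q :=
  mkop (fun x y => ((x == [ffun=> false]) && (y == [ffun=> false]))%:R).

Definition Pur (R : realType) (Q : finType) (s : op R Q) : R := retr (s *m s).

Definition subreg (Q : finType) (A : {set Q}) : finType := {q : Q | q \in A}.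

Definition rst (Q : finType) (A : {set Q}) (x : bits Q) : bits (subreg A) :=
  [ffun q : subreg A => x (val q)].

(* [tens A a b] is a (x) b, with a acting on A and b on the complement of A. *)
Definition tens (R : realType) (Q : finType) (A : {set Q})
    (a : op R (subreg A)) (b : op R (subreg (~: A))) : op R Q :=
  mkop (fun x y => ent a (rst A x) (rst A y)
                 * ent b (rst (~: A) x) (rst (~: A) y)).

(* Partial trace over the complement of A: [marg A s] is the marginal on A. *)
Definition marg (R : realType) (Q : finType) (A : {set Q}) (s : op R Q) :
    op R (subreg A) :=
  mkop (fun x y =>
    \sum_(u : bits Q | rst A u == x)
      \sum_(v : bits Q | (rst A v == y) && (rst (~: A) v == rst (~: A) u))
        ent s u v).

Definition acts_only_on (R : realType) (Q : finType) (A : {set Q})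
    (U : op R Q) : Prop :=
  exists u : op R (subreg A), U = tens u 1%:M.

Definition inl_bits (Q1 Q2 : finType) (x : bits (Q1 + Q2)%type) : bits Q1 :=
  [ffun q => x (inl q)].
Definition inr_bits (Q1 Q2 : finType) (x : bits (Q1 + Q2)%type) : bits Q2 :=
  [ffun q => x (inr q)].

Definition otimes (R : realType) (Q1 Q2 : finType) (a : op R Q1)
    (b : op R Q2) : op R (Q1 + Q2)%type :=
  mkop (fun x y => ent a (inl_bits x) (inl_bits y)
                 * ent b (inr_bits x) (inr_bits y)).

(* k copies of a state; qubit (j, q) is qubit q of copy j. *)
Definition copies (R : realType) (k : nat) (Q : finType) (s : op R Q) :
    op R ('I_k * Q)%type :=
  mkop (fun x y => \prod_(j < k)
    ent s [ffun q => x (j, q)] [ffun q => y (j, q)]).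

(* Entries of the single-qubit Paulis: (false, false), (true, false),
   (true, true), (false, true) stand for I, X, Y, Z. *)
Definition pauli1 (R : realType) (p : bool * bool) (x y : bool) : R[i] :=
  if x == y (+) p.1 then 'i ^+ (p.1 && p.2) * (-1) ^+ (p.2 && y) else 0.

Definition pauli (R : realType) (Q : finType) (p : {ffun Q -> bool * bool}) :
    op R Q :=
  mkop (fun x y => \prod_q pauli1 R (p q) (x q) (y q)).

Definition pauli_group (R : realType) (Q : finType) (A : op R Q) : Prop :=
  exists (k : nat) (p : {ffun Q -> bool * bool}), A = 'i ^+ k *: pauli R p.

(* The Clifford group as the normalizer of the Pauli group in the unitaries;
   global phases are therefore included. *)
Definition clifford (R : realType) (Q : finType) (U : op R Q) : Prop :=
  U \is unitarymx /\ forall A, pauli_group A -> pauli_group (conj_by U A).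

Definition Tgate (R : realType) (Q : finType) (q : Q) : op R Q :=
  mkop (fun x y =>
    if x == y then (if x q then (1 + 'i) / sqrtC 2 else 1) else 0).

Inductive doped (R : realType) (Q : finType) : nat -> op R Q -> Prop :=
| doped0 U : clifford U -> doped 0 U
| dopedS t U q C : clifford U -> doped t C ->
    doped t.+1 (U *m Tgate R q *m C).

(* T_pi moves the content of qubit q to qubit pi q. *)
Definition permop (R : realType) (Q : finType) (pi : {perm Q}) : op R Q :=
  mkop (fun x y => [forall q, x (pi q) == y q]%:R).

(* C = D^dagger c D V, with c supported on the t-qubit subsystem S. *)
Definition completion (R : realType) (Q : finType) (t : nat) (C D V c : op R Q)
    (S : {set Q}) : Prop :=
  [/\ [/\ clifford D, clifford V & doped t c],
      #|S| = t, acts_only_on S c & C = D^t* *m c *m D *m V].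

Definition diagonalizer (R : realType) (Q : finType) (t : nat) (C D : op R Q)
    (S : {set Q}) : Prop :=
  exists V c, completion t C D V c S.

Definition is_W (R : realType) (Q : finType) (t : nat) (C : op R Q)
    (Y : {set Q}) (W : op R Q) : Prop :=
  exists D V c S (pi : {perm Q}),
    [/\ completion t C D V c S,
        acts_only_on Y (conj_by (permop R pi) c)
      & W = permop R pi *m D].

Definition psi (R : realType) (Q : finType) (C : op R Q) : op R Q :=
  conj_by C (ket0 R Q).

(* Y carries the maximally mixed state and ~: Y the state E(psi). *)
Definition rho (R : realType) (Q : finType) (C : op R Q) (Y : {set Q})
    (W : op R Q) : op R Q :=
  conj_by (W^t*) (tens (A := Y) ((2 ^+ #|Y|)^-1 *: 1%:M)
                    (marg (~: Y) (conj_by W (psi C)))).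

(* The subsystem X among E and F = ~: E; a tie, which does not affect
   Pur (marg X s), is resolved to E. *)
Definition purer_side (R : realType) (Q : finType) (E : {set Q})
    (s : op R Q) : {set Q} :=
  if Pur (marg (~: E) s) <= Pur (marg E s) then E else ~: E.

Definition purX (R : realType) (Q : finType) (E : {set Q}) (s : op R Q) : R :=
  Pur (marg (purer_side E s) s).

(* An adaptive protocol on a register Q returning a classical value in O: it
   interleaves uses of the unknown unitary with quantum instruments, given by
   Kraus operators A_0, ..., A_(K-1), and proceeds according to the observed
   outcome.  (Unitary gates are the instruments with K = 1.) *)
Inductive protocol (R : realType) (Q : finType) (O : Type) : Type :=
| Output (o : O)
| Query (next : protocol R Q O)
| Measure (K : nat) (A : 'I_K -> op R Q) (next : 'I_K -> protocol R Q O).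

Definition kraus (R : realType) (Q : finType) (K : nat) (A : 'I_K -> op R Q) :
    Prop :=
  \sum_(k < K) (A k)^t* *m A k = 1%:M.

Fixpoint wf_protocol (R : realType) (Q : finType) (O : Type)
    (p : protocol R Q O) : Prop :=
  match p with
  | Output _ => True
  | Query p' => wf_protocol p'
  | Measure K A next => kraus A /\ forall k, wf_protocol (next k)
  end.

Fixpoint queries (R : realType) (Q : finType) (O : Type)
    (p : protocol R Q O) : nat :=
  match p with
  | Output _ => 0
  | Query p' => (queries p').+1
  | Measure K A next => \max_(k < K) queries (next k)
  end.

(* Probability that the output satisfies P, when U answers the queries and the
   current state of the register is s (not normalized: its trace is the
   probability of the branch followed so far). *)
Fixpoint run (R : realType) (Q : finType) (O : Type) (U : op R Q)
    (P : O -> Prop) (p : protocol R Q O) (s : op R Q) : R :=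
  match p with
  | Output o => if `[< P o >] then retr s else 0
  | Query p' => run U P p' (conj_by U s)
  | Measure K A next => \sum_(k < K) run U P (next k) (conj_by (A k) s)
  end.

(* Protocols with query access to a unitary on n qubits, using m ancillas. *)
Definition query_protocol (R : realType) (n m : nat) (O : Type) : Type :=
  protocol R ('I_n + 'I_m)%type O.

Definition success (R : realType) (n m : nat) (O : Type)
    (A : query_protocol R n m O) (C : op R 'I_n) (P : O -> Prop) : R :=
  run (otimes C (1%:M : op R 'I_m)) P A (ket0 R ('I_n + 'I_m)%type).

Definition log2 (R : realType) (x : R) : R := ln x / ln 2.

Definition poly_bounded (R : realType) (f : nat -> R) : Prop :=
  exists k : nat, f =O_\oo (fun n => n%:R ^+ k : R).

Definition inv_poly (R : realType) (f : nat -> R) : Prop :=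
  exists k : nat, f \is 'Omega_\oo (fun n => n%:R ^- k : R).

Definition negl (R : realType) (f : nat -> R) : Prop :=
  forall k : nat, f =O_\oo (fun n => n%:R ^- k : R).

(* The learner also returns the t-qubit subsystem S on which
   c = D C V^dagger D^dagger is supported: D alone does not determine it. *)
Definition clifford_completion (R : realType) : Prop :=
  exists (a b c : nat) (delta : nat -> R), negl delta /\
    forall n t : nat, (t <= n)%N ->
    exists (m : nat) (A : query_protocol R n m (op R 'I_n * {set 'I_n})),
      [/\ wf_protocol A, (queries A <= a * n.+1 ^ b * c ^ t)%N
        & forall C : op R 'I_n, doped t C ->
            1 - delta n <= success A C (fun o => diagonalizer t C o.1 o.2)].

(* The list G enumerates the group without repetition. *)
Definition stabilizer_group (R : realType) (Q : finType) (G : seq (op R Q)) :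
    Prop :=
  [/\ uniq G /\ {in G, forall g, pauli_group g},
      1%:M \in G,
      {in G &, forall g h, g *m h \in G},
      {in G &, forall g h, g *m h = h *m g}
    & - 1%:M \notin G].

Definition stabilizer_state (R : realType) (Q : finType) (s : op R Q) : Prop :=
  exists2 G : seq (op R Q), stabilizer_group G
    & s = (2 ^+ #|Q|)^-1 *: \sum_(g <- G) g.

(* One collective measurement on k n copies, with N outcomes; outcome o is
   decoded as the state L o. *)
Definition stabilizer_learning (R : realType) : Prop :=
  exists (k : nat -> nat) (delta : nat -> R),
    [/\ poly_bounded (fun n => (k n)%:R : R), negl delta
      & forall n : nat,
        exists (N : nat) (A : 'I_N -> op R ('I_(k n) * 'I_n)%type)
               (L : 'I_N -> op R 'I_n),
          kraus A /\
          forall s : op R 'I_n, stabilizer_state s ->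
            1 - delta n <=
              \sum_(o < N | L o == s) retr (conj_by (A o) (copies (k n) s))].

Definition swapop (R : realType) (Q : finType) : op R (Q + Q)%type :=
  mkop (fun x y =>
    ((inl_bits x == inr_bits y) && (inr_bits x == inl_bits y))%:R).

(* Probability of the outcome (-1) ^ b when the swap operator is measured on
   two copies of s. *)
Definition swap_prob (R : realType) (Q : finType) (s : op R Q) (b : bool) : R :=
  retr ((2^-1 *: (1%:M + (-1) ^+ b *: swapop R Q)) *m otimes s s).

Definition swap_estimate (R : realType) (M : nat) (o : {ffun 'I_M -> bool}) :
    R :=
  (\sum_(j < M) (-1) ^+ o j) / M%:R.

(* Probability that the average of M independent swap-test outcomes is within
   eps of the purity of s. *)
Definition swap_test_success (R : realType) (Q : finType) (s : op R Q)
    (M : nat) (eps : R) : R :=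
  \sum_(o : {ffun 'I_M -> bool} | `|swap_estimate R o - Pur s| <= eps)
    \prod_(j < M) swap_prob s (o j).

(* Main.v *)
Require Import Defs.
From mathcomp Require Import all_boot all_order all_algebra all_fingroup.
From mathcomp Require Import all_classical all_reals all_analysis.
From mathcomp Require Import complex ring lra.
Set Implicit Arguments.
Unset Strict Implicit.
Unset Printing Implicit Defensive.
Import Order.TTheory GRing.Theory Num.Theory numFieldNormedType.Exports.
Local Open Scope classical_set_scope.
Local Open Scope sesquilinear_scope.
Local Open Scope ring_scope.

(* Write U^+ for the adjoint of U. Tracing out Y and putting the maximally mixed
   state there is the same as averaging over the 4^t Pauli operators P supported
   on Y. Hence rho is the average of Q psi Q^+ over the operators Q = W^+ P W.

   These Q are Paulis because W is Clifford, so they factor through any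
   bipartition and act on a marginal psi_A by local unitaries. In Pur (rho_A) the
   16^t cross terms tr (Q psi_A Q^+ Q' psi_A Q'^+) lie between 0 and Pur (psi_A),
   and the 4^t diagonal ones equal Pur (psi_A), so that
     4^-t Pur (psi_A) <= Pur (rho_A) <= Pur (psi_A).
   As psi is pure, Pur (psi_E) = Pur (psi_F), so that A can be either side. Since
   4^t is polynomial in n, both (i) and (ii) follow, the number of swap tests
   being given by Chebyshev's inequality.

   On the other hand W psi W^+ = c' (W V |0><0| V^+ W^+) c'^+ with c' a unitary on
   Y, which the trace over Y removes: rho is obtained from a stabilizer state by a
   Pauli twirl and the Clifford W^+, hence is itself a stabilizer state (the twirl
   keeps the stabilizers commuting with all the P). It is prepared with one query
   per copy and learned exactly, and its purities are then known. *)

(** * Operators and their entries *)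

Section Entries.
Variable R : realType.
Implicit Types Q : finType.

Lemma entE Q (f : bits Q -> bits Q -> R[i]) x y : ent (mkop f) x y = f x y.
Proof. by rewrite /ent /mkop mxE !enum_rankK. Qed.

Lemma op_ext Q (A B : op R Q) : (forall x y, ent A x y = ent B x y) -> A = B.
Proof.
move=> eqAB; apply/matrixP => i j.
by have := eqAB (enum_val i) (enum_val j); rewrite /ent !enum_valK.
Qed.

Lemma sum_enum_rank (V : nmodType) (T : finType) (F : 'I_#|T| -> V) :
  \sum_i F i = \sum_(x : T) F (enum_rank x).
Proof.
rewrite (reindex (@enum_rank T)) //.
by exists enum_val => x _; rewrite ?enum_rankK ?enum_valK.
Qed.

Lemma ent_mul Q (A B : op R Q) x y :
  ent (A *m B) x y = \sum_z ent A x z * ent B z y.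
Proof. by rewrite /ent mxE sum_enum_rank. Qed.

Lemma ent_tr Q (A : op R Q) : \tr A = \sum_x ent A x x.
Proof. by rewrite /mxtrace sum_enum_rank. Qed.

Lemma ent_adj Q (A : op R Q) x y : ent (A^t*) x y = (ent A y x)^*.
Proof. by rewrite /ent !mxE. Qed.

Lemma ent1 Q x y : ent (1%:M : op R Q) x y = (x == y)%:R.
Proof. by rewrite /ent mxE (inj_eq enum_rank_inj). Qed.

Lemma entZ Q c (A : op R Q) x y : ent (c *: A) x y = c * ent A x y.
Proof. by rewrite /ent mxE. Qed.

Lemma ent_sum Q (I : Type) (r : seq I) (P : pred I) (F : I -> op R Q) x y :
  ent (\sum_(i <- r | P i) F i) x y = \sum_(i <- r | P i) ent (F i) x y.
Proof. by rewrite /ent summxE. Qed.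

Lemma ent_conj Q (U A : op R Q) x y :
  ent (conj_by U A) x y =
  \sum_u \sum_v ent U x u * ent A u v * (ent U y v)^*.
Proof.
rewrite ent_mul exchange_big; apply: eq_bigr => v _.
by rewrite ent_mul ent_adj big_distrl.
Qed.

Lemma ReD (a b : R[i]) : complex.Re (a + b) = complex.Re a + complex.Re b.
Proof. exact: raddfD. Qed.

Lemma Re_sum (I : Type) (r : seq I) (P : pred I) (F : I -> R[i]) :
  complex.Re (\sum_(i <- r | P i) F i) =
  \sum_(i <- r | P i) complex.Re (F i).
Proof. exact: raddf_sum. Qed.

Lemma Re_ge0 (a : R[i]) : 0 <= a -> 0 <= complex.Re a.
Proof. by case: a => a b /andP[]. Qed.

Lemma Re_realM (a : R) (b : R[i]) :
  complex.Re (a%:C%C * b) = a * complex.Re b.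
Proof. by case: b => b c /=; rewrite mul0r subr0. Qed.

Lemma adj_mul m n p (A : 'M[R[i]]_(m, n)) (B : 'M[R[i]]_(n, p)) :
  (A *m B)^t* = (B^t*) *m (A^t*).
Proof. by rewrite trmx_mul map_mxM. Qed.

Lemma adj1 n : (1%:M : 'M[R[i]]_n)^t* = 1%:M.
Proof. by apply/matrixP => i j; rewrite !mxE rmorph_nat eq_sym. Qed.

Lemma adjZ m n c (A : 'M[R[i]]_(m, n)) : (c *: A)^t* = c^* *: (A^t*).
Proof. by apply/matrixP => i j; rewrite !mxE rmorphM. Qed.

Lemma adjD m n (A B : 'M[R[i]]_(m, n)) : (A + B)^t* = (A^t*) + (B^t*).
Proof. by apply/matrixP => i j; rewrite !mxE rmorphD. Qed.

Lemma adjN m n (A : 'M[R[i]]_(m, n)) : (- A)^t* = - (A^t*).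
Proof. by apply/matrixP => i j; rewrite !mxE rmorphN. Qed.

Lemma unitaryP n (U : 'M[R[i]]_n) :
  U \is unitarymx -> U *m (U^t*) = 1%:M /\ (U^t*) *m U = 1%:M.
Proof. by move/unitarymxP => UU; split=> //; apply: mulmx1C. Qed.

Lemma unitary_adj n (U : 'M[R[i]]_n) : U \is unitarymx -> (U^t*) \is unitarymx.
Proof. by rewrite trmxC_unitary. Qed.

Lemma conj_byM Q (U V A : op R Q) : conj_by (U *m V) A = conj_by U (conj_by V A).
Proof. by rewrite /conj_by adj_mul !mulmxA. Qed.

Lemma conj_by1 Q (A : op R Q) : conj_by 1%:M A = A.
Proof. by rewrite /conj_by adj1 mul1mx mulmx1. Qed.

Lemma conj_byK Q (U A : op R Q) : U \is unitarymx ->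
  conj_by (U^t*) (conj_by U A) = A.
Proof. by move/unitaryP => [_ UU]; rewrite -conj_byM UU conj_by1. Qed.

Lemma conj_by_sum Q (I : Type) (r : seq I) (P : pred I) (U : op R Q)
    (F : I -> op R Q) :
  conj_by U (\sum_(i <- r | P i) F i) = \sum_(i <- r | P i) conj_by U (F i).
Proof. by rewrite /conj_by mulmx_sumr mulmx_suml. Qed.

Lemma conj_byZ Q (U : op R Q) c A : conj_by U (c *: A) = c *: conj_by U A.
Proof. by rewrite /conj_by -scalemxAr -scalemxAl. Qed.

Lemma conj_byD Q (U : op R Q) A B :
  conj_by U (A + B) = conj_by U A + conj_by U B.
Proof. by rewrite /conj_by mulmxDr mulmxDl. Qed.

Lemma conj_by_mul Q (U : op R Q) A B : U \is unitarymx ->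
  conj_by U (A *m B) = conj_by U A *m conj_by U B.
Proof.
move/unitaryP => [_ UU]; rewrite /conj_by !mulmxA -(mulmxA (U *m A) (U^t*) U) UU.
by rewrite mulmx1.
Qed.

Lemma conj_by_id Q (U : op R Q) : U \is unitarymx -> conj_by U 1%:M = 1%:M.
Proof. by move/unitaryP => [UU _]; rewrite /conj_by mulmx1. Qed.

Lemma conj_by_inj Q (U : op R Q) : U \is unitarymx -> injective (conj_by U).
Proof. by move=> uU; apply: can_inj (fun A => conj_byK A uU). Qed.

Lemma conjZ_by Q c (U A : op R Q) :
  conj_by (c *: U) A = (c * c^*) *: conj_by U A.
Proof. by rewrite /conj_by adjZ -!scalemxAl -scalemxAr scalerA. Qed.

Lemma tr_conj Q (U A : op R Q) : U \is unitarymx -> \tr (conj_by U A) = \tr A.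
Proof. by move/unitaryP => [_ UU]; rewrite mxtrace_mulC mulmxA UU mul1mx. Qed.

Lemma conj_unitary Q (U A : op R Q) : U \is unitarymx -> A \is unitarymx ->
  conj_by U A \is unitarymx.
Proof.
move=> uU uA.
exact: (mul_unitarymx (mul_unitarymx uU uA) (unitary_adj uU)).
Qed.

Lemma ent_ket0 Q x y : ent (ket0 R Q) x y =
  (x == [ffun=> false])%:R * (y == [ffun=> false])%:R.
Proof. by rewrite entE -mulnb natrM. Qed.

Lemma sum_delta (T : finType) (a : T) (F : T -> R[i]) :
  \sum_x (x == a)%:R * F x = F a.
Proof.
rewrite (bigD1 a) //= eqxx mul1r big1 ?addr0 // => x /negbTE->.
by rewrite mul0r.
Qed.

Lemma tr_ket0 Q : \tr (ket0 R Q) = 1.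
Proof.
rewrite ent_tr; under eq_bigr do rewrite ent_ket0.
by rewrite sum_delta eqxx.
Qed.

Lemma adj_ket0 Q : (ket0 R Q)^t* = ket0 R Q.
Proof.
by apply: op_ext => x y; rewrite ent_adj !ent_ket0 rmorphM !rmorph_nat mulrC.
Qed.

Lemma ket0_idem Q : ket0 R Q *m ket0 R Q = ket0 R Q.
Proof.
apply: op_ext => x y; rewrite ent_mul.
under eq_bigr do rewrite !ent_ket0 -mulrA mulrCA.
by rewrite sum_delta eqxx mul1r ent_ket0.
Qed.

End Entries.

(** * Partial traces and local operators *)

Section Gluing.
Variables (Q : finType) (A : {set Q}).

(** The innermost [false] is never reached, since every qubit lies in [A] or in its complement. *)
Definition glue (a : bits (subreg A)) (b : bits (subreg (~: A))) : bits Q :=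
  [ffun q => if insub q is Some u then a u
             else if insub q is Some v then b v else false].

Lemma rst_eqP (x y : bits Q) (B : {set Q}) :
  reflect {in B, x =1 y} (rst B x == rst B y).
Proof.
apply: (iffP eqP) => [/ffunP xy q qB|xy].
  by have := xy (Sub q qB); rewrite !ffunE.
by apply/ffunP => q; rewrite !ffunE xy //; apply: valP.
Qed.

Lemma rst_glue a b : rst A (glue a b) = a.
Proof. by apply/ffunP => q; rewrite !ffunE valK. Qed.

Lemma rstC_glue a b : rst (~: A) (glue a b) = b.
Proof.
apply/ffunP => q; rewrite !ffunE insubN ?valK //.
by have := valP q; rewrite inE.
Qed.

Lemma glue_rst x : glue (rst A x) (rst (~: A) x) = x.
Proof.
apply/ffunP => q; rewrite !ffunE; case: insubP => [u _ <-|qA].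
  by rewrite ffunE.
case: insubP => [u _ <-|]; first by rewrite ffunE.
by rewrite inE qA.
Qed.

Lemma sum_glue (V : nmodType) (F : bits Q -> V) :
  \sum_x F x = \sum_a \sum_b F (glue a b).
Proof.
rewrite pair_big /= (reindex (fun ab => glue ab.1 ab.2)) //.
exists (fun x => (rst A x, rst (~: A) x)) => [[a b] _|x _] /=.
  by rewrite rst_glue rstC_glue.
by rewrite glue_rst.
Qed.

(** The marginal on [~: A] unfolds to restrictions to [~: ~: A], whose register is a different type
    from [subreg A]. Only equality tests between restrictions carry over, and they are all that
    [ent_margC] needs. *)
Lemma rstCC_eq x y : (rst (~: ~: A) x == rst (~: ~: A) y) = (rst A x == rst A y).
Proof.
by apply/rst_eqP/rst_eqP => xy q; have := xy q; rewrite finset.setCK.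
Qed.

Variable R : realType.
Implicit Types s : op R Q.

Lemma ent_marg s a a' :
  ent (marg A s) a a' = \sum_b ent s (glue a b) (glue a' b).
Proof.
rewrite entE big_mkcond sum_glue (bigD1 a) //= [X in _ + X]big1 ?addr0.
  apply: eq_bigr => b _; rewrite rst_glue eqxx big_mkcond sum_glue.
  rewrite (bigD1 a') //= [X in _ + X]big1 ?addr0.
    rewrite (bigD1 b) //= rst_glue rstC_glue !eqxx rstC_glue eqxx /=.
    rewrite big1 ?addr0 // => b' /negbTE nb.
    by rewrite rst_glue !rstC_glue nb andbF.
  by move=> a'' /negbTE na; apply: big1 => b' _; rewrite rst_glue na.
by move=> a'' /negbTE na; apply: big1 => b' _; rewrite rst_glue na.
Qed.

Lemma ent_margC s b b' :
  ent (marg (~: A) s) b b' = \sum_a ent s (glue a b) (glue a b').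
Proof.
rewrite entE big_mkcond sum_glue; apply: eq_bigr => a _.
rewrite (bigD1 b) //= [X in _ + X]big1 ?addr0.
  rewrite rstC_glue eqxx big_mkcond sum_glue.
  rewrite (bigD1 a) //= [X in _ + X]big1 ?addr0.
    rewrite (bigD1 b') //= rstCC_eq rst_glue rstC_glue !eqxx rst_glue eqxx /=.
    rewrite big1 ?addr0 // => b'' /negbTE nb.
    by rewrite rstC_glue nb.
  move=> a'' /negbTE na; apply: big1 => b'' _.
  by rewrite rstCC_eq !rst_glue na andbF.
by move=> b'' /negbTE nb; rewrite rstC_glue nb.
Qed.

Lemma ent_tens (a : op R (subreg A)) (b : op R (subreg (~: A))) x x' y y' :
  ent (tens a b) (glue x y) (glue x' y') = ent a x x' * ent b y y'.
Proof. by rewrite entE !rst_glue !rstC_glue. Qed.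

Lemma tr_marg s : \tr (marg A s) = \tr s.
Proof.
by rewrite !ent_tr sum_glue; apply: eq_bigr => a _; rewrite ent_marg.
Qed.

End Gluing.

(** The index computation shared by the two marginals. The columns of [h] are orthonormal, so the
    sum over the traced index [b] forces [v = v'] and [h] disappears. *)
Lemma partial_trace_conj (R : realType) (T1 T2 : finType)
    (f : T1 -> T1 -> R[i]) (h : T2 -> T2 -> R[i])
    (S : T1 -> T2 -> T1 -> T2 -> R[i]) a a' :
  (forall v v', \sum_b h b v * (h b v')^* = (v == v')%:R) ->
  \sum_b \sum_u \sum_v \sum_u' \sum_v'
    (f a u * h b v) * S u v u' v' * (f a' u' * h b v')^* =
  \sum_u \sum_u' f a u * (\sum_v S u v u' v) * (f a' u')^*.
Proof.
move=> hU; rewrite exchange_big; apply: eq_bigr => u _ /=.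
under eq_bigr do rewrite exchange_big.
rewrite exchange_big; apply: eq_bigr => u' _ /=.
rewrite mulr_sumr mulr_suml exchange_big; apply: eq_bigr => v _ /=.
rewrite exchange_big /=.
transitivity (\sum_v' (v' == v)%:R * (f a u * S u v u' v' * (f a' u')^*)).
  apply: eq_bigr => v' _; rewrite [v' == v]eq_sym -hU mulr_suml.
  by apply: eq_bigr => b _; rewrite rmorphM /=; ring.
by rewrite sum_delta.
Qed.

Section LocalOperators.
Variables (R : realType) (Q : finType) (A : {set Q}).
Variables (u : op R (subreg A)) (v : op R (subreg (~: A))).
Implicit Types s : op R Q.

Lemma unitary_cols (Q' : finType) (U : op R Q') x y : U \is unitarymx ->
  \sum_b ent U b x * (ent U b y)^* = (x == y)%:R.
Proof.
move=> /unitaryP[_ UU]; rewrite eq_sym -(ent1 R) -UU ent_mul.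
by apply: eq_bigr => b _; rewrite ent_adj mulrC.
Qed.

Lemma ent_conj_tens s a b a' b' :
  ent (conj_by (tens u v) s) (glue a b) (glue a' b') =
  \sum_c \sum_d \sum_c' \sum_d' (ent u a c * ent v b d)
    * ent s (glue c d) (glue c' d') * (ent u a' c' * ent v b' d')^*.
Proof.
rewrite ent_conj (sum_glue A); apply: eq_bigr => c _; apply: eq_bigr => d _.
rewrite (sum_glue A); apply: eq_bigr => c' _; apply: eq_bigr => d' _.
by rewrite !ent_tens.
Qed.

Lemma marg_conj s : v \is unitarymx ->
  marg A (conj_by (tens u v) s) = conj_by u (marg A s).
Proof.
move=> uv; apply: op_ext => a a'; rewrite ent_marg ent_conj.
under eq_bigr do rewrite ent_conj_tens.
rewrite (@partial_trace_conj _ _ _ (ent u) (ent v)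
  (fun c d c' d' => ent s (glue c d) (glue c' d'))).
  by apply: eq_bigr => c _; apply: eq_bigr => c' _; rewrite ent_marg.
by move=> *; apply: unitary_cols.
Qed.

Lemma margC_conj s : u \is unitarymx ->
  marg (~: A) (conj_by (tens u v) s) = conj_by v (marg (~: A) s).
Proof.
move=> uu; apply: op_ext => b b'; rewrite ent_margC ent_conj.
transitivity (\sum_a \sum_d \sum_c \sum_d' \sum_c'
    (ent v b d * ent u a c) * ent s (glue c d) (glue c' d')
    * (ent v b' d' * ent u a c')^*).
  apply: eq_bigr => a _; rewrite ent_conj_tens exchange_big.
  apply: eq_bigr => d _; apply: eq_bigr => c _; rewrite exchange_big.
  apply: eq_bigr => d' _; apply: eq_bigr => c' _.
  by rewrite [ent u a c * _]mulrC [ent u a c' * _]mulrC.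
rewrite (@partial_trace_conj _ _ _ (ent v) (ent u)
  (fun d c d' c' => ent s (glue c d) (glue c' d'))).
  by apply: eq_bigr => c _; apply: eq_bigr => c' _; rewrite ent_margC.
by move=> *; apply: unitary_cols.
Qed.

End LocalOperators.

Lemma tens_mul (R : realType) (Q : finType) (A : {set Q})
    (a a' : op R (subreg A)) (b b' : op R (subreg (~: A))) :
  tens a b *m tens a' b' = tens (a *m a') (b *m b').
Proof.
apply: op_ext => x y; rewrite -(glue_rst A x) -(glue_rst A y).
rewrite ent_mul (sum_glue A) ent_tens !ent_mul big_distrlr /=.
by apply: eq_bigr => c _; apply: eq_bigr => d _; rewrite !ent_tens mulrACA.
Qed.

Lemma tens_adj (R : realType) (Q : finType) (A : {set Q})
    (a : op R (subreg A)) (b : op R (subreg (~: A))) :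
  (tens a b)^t* = tens (a^t*) (b^t*).
Proof.
apply: op_ext => x y.
by rewrite ent_adj [in LHS]entE [in RHS]entE rmorphM !ent_adj.
Qed.

(** With one fixed assignment [z] on the complement in both row and column, the entries of the
    unitarity equation reduce to those for [a]. *)
Lemma unitary_tens1 (R : realType) (Q : finType) (A : {set Q})
    (a : op R (subreg A)) :
  tens a (1%:M : op R (subreg (~: A))) \is unitarymx -> a \is unitarymx.
Proof.
move=> /unitaryP[+ _]; rewrite tens_adj tens_mul adj1 mulmx1 => aa.
apply/unitarymxP; apply: op_ext => x y.
pose z : bits (subreg (~: A)) := [ffun=> false].
have := congr1 (fun B => ent B (glue x z) (glue y z)) aa.
rewrite ent_tens !ent1 eqxx mulr1 => ->; congr (_%:R); congr nat_of_bool.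
by apply/eqP/eqP => [/(congr1 (rst A))|->//]; rewrite !rst_glue.
Qed.

(** * The Pauli and Clifford groups *)

Section PauliMatrices.
Variable R : realType.
Implicit Types p r : (bool * bool)%type.

Lemma imaginary_mul : 'i * 'i = -1 :> R[i].
Proof. by rewrite -expr2 sqrCi. Qed.

Definition pauli1D p r := (p.1 (+) r.1, p.2 (+) r.2).

(** A label (x, z) stands for i^(xz) X^x Z^z. The first two terms are the prefactors of [p] and [r],
    the third is the sign from moving Z^(p.2) past X^(r.1), and the last divides by the prefactor of
    the product, as i^3 = i^-1. *)
Definition pauli1_phase p r : nat :=
  (p.1 && p.2) + (r.1 && r.2) + 2 * (p.2 && r.1)
  + 3 * ((p.1 (+) r.1) && (p.2 (+) r.2)).

Lemma pauli1_adj p x y : (pauli1 R p y x)^* = pauli1 R p x y.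
Proof.
case: p x y => [[] []] [] []; rewrite /pauli1 /= ?rmorph0 //.
all: rewrite ?rmorphM /= ?rmorph1 ?rmorphN1 ?conjCi ?mulr1 ?mul1r ?mulrN1.
all: by rewrite ?opprK ?rmorph1 ?rmorphN1 ?expr1 ?expr0.
Qed.

Lemma pauli1_mul p r x y :
  \sum_z pauli1 R p x z * pauli1 R r z y =
  'i ^+ pauli1_phase p r * pauli1 R (pauli1D p r) x y.
Proof.
have i2 := imaginary_mul.
rewrite big_bool /=; case: p r x y => [[] []] [[] []] [] [];
rewrite /pauli1 /pauli1_phase /pauli1D /= ?mulr0 ?mul0r ?addr0 ?add0r //.
all: rewrite ?expr0 ?expr1 ?mulr1 ?mul1r //.
all: rewrite ?exprS ?expr0 ?mulr1 //.
all: by ring: i2.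
Qed.

(** The exponent of -1 is the symplectic form of the two labels, whose parity decides between
    commuting and anticommuting. *)
Lemma pauli1_phaseC p r :
  'i ^+ pauli1_phase p r =
  (-1) ^+ ((p.2 && r.1) + (r.2 && p.1)) * 'i ^+ pauli1_phase r p :> R[i].
Proof.
have i2 := imaginary_mul.
case: p r => [[] []] [[] []]; rewrite /pauli1_phase /= ?exprS ?expr0 ?mulr1 ?mul1r //.
all: by ring: i2.
Qed.

End PauliMatrices.

Section PauliGroup.
Variables (R : realType) (Q : finType).
Implicit Types (p r : {ffun Q -> bool * bool}) (g h : op R Q).

Definition pauliD p r : {ffun Q -> bool * bool} := [ffun q => pauli1D (p q) (r q)].
Definition pauli0 : {ffun Q -> bool * bool} := [ffun=> (false, false)].

Lemma pauliDK r : involutive (fun p => pauliD p r).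
Proof.
move=> p; apply/ffunP => q; rewrite !ffunE /pauli1D /=.
by case: (p q) (r q) => [[] []] [[] []].
Qed.

Lemma pauli_mul p r :
  pauli R p *m pauli R r =
  'i ^+ (\sum_q pauli1_phase (p q) (r q)) *: pauli R (pauliD p r).
Proof.
apply: op_ext => x y; rewrite entZ ent_mul entE expr_sum -big_split /=.
(* A product of tensor products is taken qubit by qubit: the sum over assignments of a product over
   qubits is the product of the single-qubit sums. *)
transitivity (\prod_q \sum_z pauli1 R (p q) (x q) z * pauli1 R (r q) z (y q)).
  rewrite bigA_distr_bigA; apply: eq_bigr => z _.
  by rewrite !entE -big_split.
by apply: eq_bigr => q _; rewrite pauli1_mul ffunE.
Qed.

Lemma pauli_adj p : (pauli R p)^t* = pauli R p.
Proof.
apply: op_ext => x y; rewrite ent_adj !entE rmorph_prod.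
by apply: eq_bigr => q _; exact: pauli1_adj.
Qed.

Lemma pauli01 : pauli R pauli0 = 1%:M.
Proof.
apply: op_ext => x y; rewrite ent1 entE.
have [->|/eqP/ffunP nxy] := eqVneq x y.
  by apply: big1 => q _; rewrite ffunE /pauli1 addbF eqxx !expr0 mulr1.
apply/eqP/prodf_eq0; have [/existsP[q nq]|] := boolP [exists q, x q != y q].
  by exists q => //; rewrite ffunE /pauli1 addbF (negbTE nq).
by rewrite negb_exists => /forallP xy; case: nxy => q; apply/eqP/negPn/xy.
Qed.

Lemma imaginary_exp4 : 'i ^+ 4 = 1 :> R[i].
Proof. by rewrite (exprM _ 2 2) sqrCi sqrrN expr1n. Qed.

Lemma pauli_sqr p : pauli R p *m pauli R p = 1%:M.
Proof.
rewrite pauli_mul -pauli01; have -> : pauliD p p = pauli0.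
  by apply/ffunP => q; rewrite !ffunE /pauli1D !addbb.
rewrite -[RHS]scale1r expr_sum big1 // => q _.
by case: (p q) => [[] []]; rewrite /pauli1_phase /= ?expr0 ?imaginary_exp4.
Qed.

Lemma pauli_unitary p : pauli R p \is unitarymx.
Proof. by apply/unitarymxP; rewrite pauli_adj pauli_sqr. Qed.

Lemma pauli_comm p r : exists b : bool,
  pauli R p *m pauli R r = (-1) ^+ b *: (pauli R r *m pauli R p).
Proof.
exists (odd (\sum_q (((p q).2 && (r q).1) + ((r q).2 && (p q).1)))).
rewrite signr_odd !pauli_mul scalerA.
have -> : pauliD r p = pauliD p r.
  apply/ffunP => q; rewrite !ffunE /pauli1D.
  by rewrite [(r q).1 (+) _]addbC [(r q).2 (+) _]addbC.
congr (_ *: _); rewrite !expr_sum -big_split; apply: eq_bigr => q _ /=.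
exact: pauli1_phaseC.
Qed.

Lemma imaginary_expM_conj k : 'i ^+ k * ('i ^+ k)^* = 1 :> R[i].
Proof. by rewrite rmorphXn /= -exprMn conjCi mulrN imaginary_mul opprK expr1n. Qed.

Lemma conj_pauli p g : pauli_group g ->
  exists b : bool, conj_by (pauli R p) g = (-1) ^+ b *: g.
Proof.
move=> [k [r ->]]; have [b pr] := pauli_comm p r; exists b.
rewrite conj_byZ /conj_by pr pauli_adj -scalemxAl -mulmxA pauli_sqr mulmx1.
by rewrite !scalerA mulrC.
Qed.

Lemma conj_pauliD p r g :
  conj_by (pauli R (pauliD p r)) g = conj_by (pauli R p) (conj_by (pauli R r) g).
Proof. by rewrite -conj_byM pauli_mul conjZ_by imaginary_expM_conj scale1r. Qed.

Lemma clifford_unitary (U : op R Q) : clifford U -> U \is unitarymx.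
Proof. by case. Qed.

(* The Pauli group is finite, so the injection A |-> U A U^+ maps it onto
   itself. *)
Lemma clifford_adj (U : op R Q) : clifford U -> clifford (U^t*).
Proof.
move=> [uU cU]; split; first exact: unitary_adj.
(* Since i^4 = 1, four phases exhaust the group; [undup] makes the list duplicate-free, as the
   counting argument requires. *)
pose L := undup [seq 'i ^+ nat_of_ord kp.1 *: pauli R kp.2
                | kp : 'I_4 * {ffun Q -> bool * bool}].
have LP A : reflect (pauli_group A) (A \in L).
  rewrite mem_undup; apply: (iffP mapP) => [[kp _ ->]|[k [p ->]]].
    by exists kp.1, kp.2.
  exists (Ordinal (ltn_pmod k (isT : 0 < 4)%N), p); first by rewrite mem_enum.
  by rewrite /= {1}(divn_eq k 4) exprD mulnC exprM imaginary_exp4 expr1n mul1r.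
have uL : uniq (map (conj_by U) L).
  by rewrite map_inj_uniq ?undup_uniq //; apply: conj_by_inj.
have sL : {subset map (conj_by U) L <= L}.
  by move=> _ /mapP[B /LP pB ->]; apply/LP/cU.
have [_ eL] := uniq_min_size uL sL (eq_leq (esym (size_map _ _))).
move=> A /LP; rewrite -eL => /mapP[B /LP pB ->].
by rewrite conj_byK.
Qed.

Lemma clifford_mul (U V : op R Q) : clifford U -> clifford V ->
  clifford (U *m V).
Proof.
move=> [uU cU] [uV cV]; split; first exact: (mul_unitarymx uU uV).
by move=> A /cV/cU; rewrite conj_byM.
Qed.

End PauliGroup.

(** * Stabilizer states and the Pauli twirl *)

Section StabilizerStates.
Variables (R : realType) (Q : finType).
Implicit Types (p r : {ffun Q -> bool * bool}) (g h s : op R Q).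

Lemma stabilizer_conj (U : op R Q) s :
  clifford U -> stabilizer_state s -> stabilizer_state (conj_by U s).
Proof.
move=> [uU cU] [G [[uG pG] G1 GM GC GN1] ->].
exists (map (conj_by U) G); last first.
  by rewrite big_map conj_byZ conj_by_sum.
split; first split.
- by rewrite map_inj_uniq //; apply: conj_by_inj.
- by move=> _ /mapP[g gG ->]; apply/cU/pG.
- by apply/mapP; exists 1%:M; rewrite ?conj_by_id.
- move=> _ _ /mapP[g gG ->] /mapP[h hG ->].
  by rewrite -conj_by_mul //; apply/map_f/GM.
- move=> _ _ /mapP[g gG ->] /mapP[h hG ->].
  by rewrite -(conj_by_mul _ _ uU) -(conj_by_mul _ _ uU) GC.
- apply: contra GN1 => /mapP[g gG eg]; suff -> : - 1%:M = g by [].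
  apply: (conj_by_inj uU).
  by rewrite -eg -scaleN1r conj_byZ conj_by_id ?scaleN1r.
Qed.

(** Z on the qubits where [b] is true and I elsewhere. These strings form the stabilizer group of
    |0...0>. *)
Definition zstring (b : bits Q) : op R Q := pauli R [ffun q => (false, b q)].

Lemma ent_zstring b x y :
  ent (zstring b) x y = (x == y)%:R * \prod_q (-1) ^+ (b q && y q).
Proof.
rewrite entE; have [->|/eqP/ffunP nxy] := eqVneq x y.
  rewrite mul1r; apply: eq_bigr => q _.
  by rewrite ffunE /pauli1 addbF eqxx expr0 mul1r.
rewrite mul0r; apply/eqP/prodf_eq0.
have [/existsP[q nq]|] := boolP [exists q, x q != y q].
  by exists q => //; rewrite ffunE /pauli1 addbF (negbTE nq).
by rewrite negb_exists => /forallP xy; case: nxy => q; apply/eqP/negPn/xy.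
Qed.

Lemma zstring_mul b c :
  zstring b *m zstring c = zstring [ffun q => b q (+) c q].
Proof.
rewrite /zstring pauli_mul expr_sum big1; last first.
  by move=> q _; rewrite !ffunE /pauli1_phase /=; case: (b q) (c q) => [] [].
rewrite scale1r; congr pauli; apply/ffunP => q.
by rewrite !ffunE /pauli1D.
Qed.

Lemma zstring_inj : injective zstring.
Proof.
move=> b c bc; apply/ffunP => q.
(* On the basis state in which only qubit [q] is set, the diagonal entry of a Z-string is the sign
   given by its bit at [q]. *)
pose x : bits Q := [ffun q' => q' == q].
have ent_x d : ent (zstring d) x x = (-1) ^+ d q.
  rewrite ent_zstring eqxx mul1r (bigD1 q) //= ffunE eqxx andbT.
  by rewrite big1 ?mulr1 // => q' /negbTE nq; rewrite ffunE nq andbF.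
have := congr1 (fun A => ent A x x) bc.
rewrite /= !ent_x; case: (b q) (c q) => [] [] // /eqP.
  by rewrite expr0 expr1 eq_sym -addr_eq0 (_ : 1 + 1 = 2%:R) // pnatr_eq0.
by rewrite expr0 expr1 -addr_eq0 (_ : 1 + 1 = 2%:R) // pnatr_eq0.
Qed.

(** The normalized sum of all Z-strings factors into the projections (I + Z)/2 = |0><0| on the
    single qubits. *)
Lemma stabilizer_ket0 : stabilizer_state (ket0 R Q).
Proof.
exists (map zstring (enum (bits Q))).
  split; first split.
  - by rewrite map_inj_uniq ?enum_uniq //; apply: zstring_inj.
  - move=> _ /mapP[b _ ->].
    by exists 0%N, [ffun q => (false, b q)]; rewrite scale1r.
  - apply/mapP; exists [ffun=> false]; rewrite ?mem_enum // -pauli01.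
    by congr pauli; apply/ffunP => q; rewrite !ffunE.
  - move=> _ _ /mapP[b _ ->] /mapP[c _ ->].
    by rewrite zstring_mul map_f // mem_enum.
  - move=> _ _ /mapP[b _ ->] /mapP[c _ ->]; rewrite !zstring_mul.
    by congr zstring; apply/ffunP => q; rewrite !ffunE addbC.
  - apply/negP => /mapP[b _].
    (* Every Z-string fixes |0...0>, so its entry there is 1, which excludes -1 from the group. *)
    pose z : bits Q := [ffun=> false].
    move=> /(congr1 (fun A => ent A z z)).
    rewrite ent_zstring big1; last by move=> q _; rewrite ffunE andbF.
    rewrite -scaleN1r entZ ent1 eqxx !mulr1 => /eqP.
    by rewrite eq_sym -addr_eq0 (_ : 1 + 1 = 2%:R) // pnatr_eq0.
rewrite big_map big_enum /=; apply: op_ext => x y.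
rewrite entZ ent_sum ent_ket0; under eq_bigr do rewrite ent_zstring.
rewrite -mulr_sumr -(bigA_distr_bigA (fun q b => (-1) ^+ (b && y q))) /=.
have [->|nxy] := eqVneq x y; last first.
  rewrite mul0r mulr0; have [x0|] := eqVneq x [ffun=> false].
    by rewrite -x0 eq_sym (negbTE nxy) mulr0.
  by rewrite mul0r.
rewrite mul1r; have [->|nx] := eqVneq y [ffun=> false].
  rewrite mul1r (eq_bigr (fun=> 2)).
    by rewrite prodr_const mulVf // expf_neq0 // pnatr_eq0.
  by move=> q _; rewrite ffunE big_bool /= expr0.
(* A qubit that is set in [y] contributes the factor 1 - 1 = 0. *)
have /existsP[q yq] : [exists q, y q].
  apply: contraNT nx; rewrite negb_exists => /forallP yF.
  by apply/eqP/ffunP => q; rewrite ffunE; apply/negbTE/yF.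
by rewrite (bigD1 q) //= big_bool /= yq expr1 expr0 addNr !mul0r mulr0.
Qed.

Variable Y : {set Q}.

(** Written as a [family] of choices made separately for each qubit, so that sums of products over
    these labels turn into products of sums. *)
Definition paulis_on : pred {ffun Q -> bool * bool} :=
  family (fun q : Q => [pred w : bool * bool | (q \in Y) || (w == (false, false))]).

Lemma sum_paulis_on (F : Q -> bool * bool -> R[i]) :
  \sum_(p | paulis_on p) \prod_q F q (p q) =
  \prod_q \sum_(w | (q \in Y) || (w == (false, false))) F q w.
Proof. by rewrite bigA_distr_big_dep. Qed.

Lemma paulis_onP p :
  reflect (forall q, q \notin Y -> p q = (false, false)) (paulis_on p).
Proof.
apply: (iffP familyP) => [pY q /negbTE qY|pY q].
  by have := pY q; rewrite inE qY => /eqP.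
by rewrite inE; case: (boolP (q \in Y)) => //= /pY ->.
Qed.

Lemma paulis_onD p r : paulis_on p -> paulis_on r -> paulis_on (pauliD p r).
Proof.
move=> /paulis_onP pY /paulis_onP rY; apply/paulis_onP => q qY.
by rewrite ffunE pY ?rY.
Qed.

(** Multiplication by a Pauli on [Y] permutes the Paulis on [Y] up to phase: on labels it is a
    translation, and an involution. *)
Lemma sum_paulis_onD (V : nmodType) r (F : {ffun Q -> bool * bool} -> V) :
  paulis_on r ->
  \sum_(p | paulis_on p) F p = \sum_(p | paulis_on p) F (pauliD p r).
Proof.
move=> rY; rewrite (reindex_inj (inv_inj (pauliDK r))) /=.
apply: eq_bigl => p; apply/idP/idP => pY; last exact: paulis_onD.
by rewrite -(pauliDK r p) paulis_onD.
Qed.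

Lemma sum_pauli_bits (V : nmodType) (F : bool * bool -> V) :
  \sum_w F w =
  F (true, true) + F (true, false) + (F (false, true) + F (false, false)).
Proof.
rewrite (eq_bigr (fun w => F (w.1, w.2))); last by case.
by rewrite -(pair_bigA _ (fun a b => F (a, b))) /= !big_bool.
Qed.

Lemma prod_if_in c : \prod_q (if q \in Y then c else 1) = c ^+ #|Y| :> R[i].
Proof. by rewrite -big_mkcond prodr_const. Qed.

Lemma card_paulis_on : \sum_(p | paulis_on p) 1 = 4 ^+ #|Y| :> R[i].
Proof.
transitivity (\sum_(p | paulis_on p) \prod_(q : Q) (1 : R[i])).
  by apply: eq_bigr => p _; rewrite big1.
rewrite (sum_paulis_on (fun _ _ => 1)) -prod_if_in; apply: eq_bigr => q _.
case: ifP => _ /=; last by rewrite big_pred1_eq.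
by rewrite sum_pauli_bits; ring.
Qed.

(** The Pauli twirl over [Y], which is the completely depolarizing channel on these qubits. *)
Definition twirl s : op R Q :=
  (4 ^+ #|Y|)^-1 *: \sum_(p | paulis_on p) conj_by (pauli R p) s.

(** A Pauli [g] that is not fixed by all conjugations anticommutes with some [r] on [Y]. Translating
    the sum by [r] then changes the sign of every term, so the sum vanishes. *)
Lemma twirl_pauli g : pauli_group g ->
  twirl g = if [forall (p | paulis_on p), conj_by (pauli R p) g == g]
            then g else 0.
Proof.
move=> pg; rewrite /twirl; case: ifPn => [/forall_inP gC|].
  rewrite (eq_bigr (fun=> 1 *: g)); last first.
    by move=> p /gC/eqP->; rewrite scale1r.
  by rewrite -scaler_suml card_paulis_on scalerA mulVf ?scale1r.
rewrite negb_forall_in => /exists_inP[r rY].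
have [[] gr] := conj_pauli r pg; last by rewrite gr expr0 scale1r eqxx.
move=> _; suff -> : \sum_(p | paulis_on p) conj_by (pauli R p) g = 0.
  by rewrite scaler0.
(* The sum is added to its translate by [r]; the terms cancel in pairs, which gives 2 S = 0. *)
set S := \sum_(p | _) _; suff /eqP : (2 : R[i]) *: S = 0.
  by rewrite scaler_eq0 pnatr_eq0 => /eqP.
rewrite (_ : 2 = 1 + 1) // scalerDl !scale1r {1}/S.
rewrite (sum_paulis_onD _ rY) -big_split big1 //= => p _.
by rewrite conj_pauliD gr conj_byZ expr1 scaleN1r addNr.
Qed.

(* Averaging over the Paulis on Y keeps exactly the elements of the
   stabilizer group that commute with all of them. *)
Lemma stabilizer_twirl s : stabilizer_state s -> stabilizer_state (twirl s).
Proof.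
move=> [G [[uG pG] G1 GM GC GN1] ->].
pose a g := [forall (p | paulis_on p), conj_by (pauli R p) g == g].
exists [seq g <- G | a g].
  split; first split.
  - exact: seq.filter_uniq.
  - by move=> g; rewrite mem_filter => /andP[_ /pG].
  - rewrite mem_filter G1 andbT; apply/forall_inP => p _.
    by rewrite conj_by_id ?pauli_unitary.
  - move=> g h; rewrite !mem_filter => /andP[/forall_inP ag gG].
    move=> /andP[/forall_inP ah hG]; rewrite GM // andbT.
    apply/forall_inP => p pY; rewrite conj_by_mul ?pauli_unitary //.
    by rewrite (eqP (ag p pY)) (eqP (ah p pY)).
  - move=> g h; rewrite !mem_filter => /andP[_ gG] /andP[_ hG].
    exact: GC.
  - by rewrite mem_filter (negbTE GN1) andbF.
rewrite /twirl; under eq_bigr do rewrite conj_byZ conj_by_sum.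
rewrite -scaler_sumr exchange_big /=.
transitivity ((2 ^+ #|Q|)^-1 *: ((4 ^+ #|Y|)^-1 *:
    \sum_(g <- G) \sum_(p | paulis_on p) conj_by (pauli R p) g)).
  move: (4 ^+ _)^-1 (2 ^+ _)^-1 => b c.
  by rewrite !scalerA mulrC.
congr (_ *: _).
rewrite scaler_sumr big_filter [RHS]big_mkcond !big_seq.
by apply: eq_bigr => g gG; have := twirl_pauli (pG g gG).
Qed.

End StabilizerStates.

(** * The Pauli twirl as a partial trace followed by a maximally mixed state *)

Section TwirlIsPartialTrace.
Variables (R : realType) (Q : finType) (Y : {set Q}).
Implicit Types s : op R Q.

(** Completeness relation: divided by the square root of 2, the four Paulis form an orthonormal
    basis of the 2 x 2 matrices. *)
Lemma sum_pauli1_sandwich x u y v :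
  \sum_w pauli1 R w x u * (pauli1 R w y v)^* =
  2 * (x == y)%:R * (u == v)%:R.
Proof.
rewrite sum_pauli_bits; case: x u y v => [] [] [] [];
rewrite /pauli1 /= ?expr0 ?expr1 ?mulr1 ?mul1r ?mulr0 ?mul0r ?rmorph0 ?mulr0 ?addr0 ?add0r
  ?rmorphM /= ?rmorph1 ?rmorphN1 ?conjCi ?mulr1 //.
all: have i2 := imaginary_mul R; by ring: i2.
Qed.

Lemma eq_ffun_prod (T : finType) (A : {set T}) (x y : T -> bool) :
  \prod_q (if q \in A then (x q == y q)%:R else 1) =
  [forall (q | q \in A), x q == y q]%:R :> R[i].
Proof.
rewrite -big_mkcond /=.
have [/forall_inP xy|] := boolP [forall (q | q \in A), x q == y q].
  by apply: big1 => q /xy ->.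
rewrite negb_forall_in => /exists_inP[q qA /negbTE nq].
by apply/eqP/prodf_eq0; exists q; rewrite ?nq.
Qed.

Lemma rst_forall (B : {set Q}) (x y : bits Q) :
  [forall (q | q \in B), x q == y q] = (rst B x == rst B y).
Proof.
by apply/forall_inP/rst_eqP => xy q /xy => [/eqP|->].
Qed.

(** Each qubit of [Y] contributes the completeness relation. Each other qubit carries the identity,
    which forces [x = u] and [y = v] there. *)
Lemma sum_paulis_on_sandwich x u y v :
  \sum_(p | paulis_on Y p) ent (pauli R p) x u * (ent (pauli R p) y v)^* =
  2 ^+ #|Y| * (rst Y x == rst Y y)%:R * (rst Y u == rst Y v)%:R
  * (rst (~: Y) x == rst (~: Y) u)%:R * (rst (~: Y) y == rst (~: Y) v)%:R.
Proof.
transitivity (\sum_(p | paulis_on Y p) \prod_q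
    (pauli1 R (p q) (x q) (u q) * (pauli1 R (p q) (y q) (v q))^*)).
  by apply: eq_bigr => p _; rewrite !entE rmorph_prod -big_split.
rewrite (sum_paulis_on Y
  (fun q w => pauli1 R w (x q) (u q) * (pauli1 R w (y q) (v q))^*)).
rewrite -prod_if_in -!rst_forall -!eq_ffun_prod -!big_split /=.
apply: eq_bigr => q _; rewrite !inE; case: ifP => _ /=.
  by rewrite sum_pauli1_sandwich !mulr1.
rewrite big_pred1_eq /pauli1 !addbF !expr0 !mulr1 !mul1r.
by case: eqP; case: eqP; rewrite ?rmorph1 ?rmorph0 ?mulr1 ?mulr0.
Qed.

Lemma twirlE s :
  twirl Y s = tens (A := Y) ((2 ^+ #|Y|)^-1 *: 1%:M) (marg (~: Y) s).
Proof.
apply: op_ext => x y; rewrite -(glue_rst Y x) -(glue_rst Y y).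
move: (rst Y x) (rst Y y) (rst (~: Y) x) (rst (~: Y) y) => a a' b b'.
rewrite ent_tens !entZ ent_sum ent1 ent_margC.
transitivity ((4 ^+ #|Y|)^-1 * (\sum_c \sum_d (d == b)%:R *
    \sum_c' (c' == c)%:R * \sum_d' (d' == b')%:R *
      (2 ^+ #|Y| * (a == a')%:R * ent s (glue c d) (glue c' d')))).
  congr (_ * _); under eq_bigr do rewrite ent_conj.
  rewrite exchange_big (sum_glue Y) /=; apply: eq_bigr => c _.
  apply: eq_bigr => d _; rewrite exchange_big (sum_glue Y) /= mulr_sumr.
  apply: eq_bigr => c' _; rewrite !mulr_sumr; apply: eq_bigr => d' _.
  transitivity (ent s (glue c d) (glue c' d') *
    \sum_(p | paulis_on Y p) ent (pauli R p) (glue a b) (glue c d)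
      * (ent (pauli R p) (glue a' b') (glue c' d'))^*).
    by rewrite mulr_sumr; apply: eq_bigr => p _; ring.
  rewrite sum_paulis_on_sandwich !rst_glue !rstC_glue.
  by rewrite [c' == c]eq_sym [d == b]eq_sym [d' == b']eq_sym; ring.
(* The normalization 4^-|Y| of the twirl and the factor 2^|Y| of the completeness relation leave the
   weight 2^-|Y| of the maximally mixed state. *)
have : (4 ^+ #|Y|)^-1 * 2 ^+ #|Y| = (2 ^+ #|Y|)^-1 :> R[i].
  have -> : 4 = 2 * 2 :> R[i] by ring.
  by rewrite exprMn invfM -mulrA mulVf ?mulr1 // expf_neq0 // pnatr_eq0.
move: (4 ^+ _)^-1 (2 ^+ #|Y|) (2 ^+ _)^-1 => k4 k2 l2 <-.
rewrite -!mulrA; congr (_ * _); rewrite !mulr_sumr.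
by apply: eq_bigr => c _; rewrite !sum_delta mulrA.
Qed.

End TwirlIsPartialTrace.

(** * Purity of Pauli averages *)

Section Purity.
Variable R : realType.
Implicit Types Q : finType.

(** Positivity is stated through a factorization, with any number of columns, because a factor can
    be written down directly for conjugates, marginals and tensor products. *)
Definition psd Q (s : op R Q) : Prop :=
  exists k (B : 'M[R[i]]_(#|bits Q|, k)), s = B *m (B^t*).

Lemma psd_adj Q (s : op R Q) : psd s -> s^t* = s.
Proof. by move=> [k [B ->]]; rewrite adj_mul trmxCK. Qed.

Lemma psd_conj Q (U s : op R Q) : psd s -> psd (conj_by U s).
Proof.
move=> [k [B ->]]; exists k, (U *m B).
by rewrite adj_mul /conj_by !mulmxA.
Qed.

Lemma psd_ket0 Q : psd (ket0 R Q).
Proof. by exists _, (ket0 R Q); rewrite adj_ket0 ket0_idem. Qed.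

Lemma psd_marg Q (A : {set Q}) (s : op R Q) : psd s -> psd (marg A s).
Proof.
move=> [k [B ->]].
(* The traced-out bits move from the row index of [B] to the column index of the new factor. *)
pose C : 'M[R[i]]_(#|bits (subreg A)|, #|{: bits (subreg (~: A)) * 'I_k}|) :=
  \matrix_(i, j) B (enum_rank (glue (enum_val i) (enum_val j).1)) (enum_val j).2.
exists _, C; apply: op_ext => x y; rewrite ent_marg {2}/ent mxE sum_enum_rank.
transitivity (\sum_b \sum_j B (enum_rank (glue x b)) j
                          * (B (enum_rank (glue y b)) j)^*).
  by apply: eq_bigr => b _; rewrite /ent mxE; apply: eq_bigr => j _; rewrite !mxE.
rewrite pair_bigA; apply: eq_bigr => p _.
by rewrite !mxE !enum_rankK.
Qed.

Lemma tr_mul_adj_ge0 m n (M : 'M[R[i]]_(m, n)) : 0 <= \tr (M *m (M^t*)).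
Proof.
apply: sumr_ge0 => i _; rewrite mxE; apply: sumr_ge0 => j _.
by rewrite !mxE mul_conjC_ge0.
Qed.

Lemma retr_psd_ge0 Q (s : op R Q) : psd s -> 0 <= retr s.
Proof. by move=> [k [B ->]]; apply/Re_ge0/tr_mul_adj_ge0. Qed.

(** By cyclicity the trace of B B^+ C C^+ is the squared Hilbert-Schmidt norm of B^+ C. *)
Lemma retr_psd_mul_ge0 Q (s r : op R Q) : psd s -> psd r -> 0 <= retr (s *m r).
Proof.
move=> [k [B ->]] [l [C ->]]; apply: Re_ge0.
have -> : \tr (B *m (B^t*) *m (C *m (C^t*))) =
          \tr (((B^t*) *m C) *m (((B^t*) *m C)^t*)).
  by rewrite adj_mul trmxCK -!mulmxA mxtrace_mulC !mulmxA.
exact: tr_mul_adj_ge0.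
Qed.

Lemma retr_sqr_ge0 Q (s : op R Q) : s^t* = s -> 0 <= Pur s.
Proof. by move=> ss; apply: Re_ge0; rewrite -{2}ss tr_mul_adj_ge0. Qed.

Lemma retrD Q (s r : op R Q) : retr (s + r) = retr s + retr r.
Proof. by rewrite /retr mxtraceD ReD. Qed.

Lemma retrZ Q (c : R) (s : op R Q) : retr (c%:C%C *: s) = c * retr s.
Proof. by rewrite /retr mxtraceZ Re_realM. Qed.

Lemma retrN Q (s : op R Q) : retr (- s) = - retr s.
Proof. by rewrite /retr raddfN /= raddfN. Qed.

Lemma retr_sum Q (I : Type) (r : seq I) (P : pred I) (F : I -> op R Q) :
  retr (\sum_(i <- r | P i) F i) = \sum_(i <- r | P i) retr (F i).
Proof.
rewrite /retr -Re_sum; congr complex.Re.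
exact: (raddf_sum (@mxtrace R[i] #|bits Q|)).
Qed.

Lemma retr_mulC Q (s r : op R Q) : retr (s *m r) = retr (r *m s).
Proof. by rewrite /retr mxtrace_mulC. Qed.

Lemma retr_conj Q (U s : op R Q) : U \is unitarymx ->
  retr (conj_by U s) = retr s.
Proof. by move=> uU; rewrite /retr tr_conj. Qed.

Lemma Pur_conj Q (U s : op R Q) : U \is unitarymx -> Pur (conj_by U s) = Pur s.
Proof. by move=> uU; rewrite /Pur -conj_by_mul // retr_conj. Qed.

(** The purity of a Hermitian operator is the sum of the squared moduli of its entries; if it were
    zero the operator would vanish, against trace 1. *)
Lemma Pur_gt0 Q (s : op R Q) : s^t* = s -> retr s = 1 -> 0 < Pur s.
Proof.
move=> ss s1; rewrite lt_neqAle retr_sqr_ge0 // andbT.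
apply/eqP => /esym P0; have trE : \tr (s *m s) = \sum_x \sum_y `|ent s x y| ^+ 2.
  rewrite ent_tr; apply: eq_bigr => x _; rewrite ent_mul.
  by apply: eq_bigr => y _; rewrite -{2}ss ent_adj normCK.
(* [Pur] keeps only the real part; the trace is nonnegative as a complex number, so its imaginary
   part is zero too. *)
have tr0 : \tr (s *m s) = 0.
  have : 0 <= \tr (s *m s) by rewrite -{2}ss tr_mul_adj_ge0.
  move: P0; rewrite /Pur /retr; case: (\tr _) => a b /= -> /andP[/eqP/= bE _].
  by rewrite bE.
have s0 x y : ent s x y = 0.
  have /psumr_eq0P := etrans (esym trE) tr0.
  move=> /(_ (fun x _ => sumr_ge0 _ (fun y _ => exprn_ge0 2 (normr_ge0 _)))).
  move=> /(_ x isT) /psumr_eq0P.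
  move=> /(_ (fun y _ => exprn_ge0 2 (normr_ge0 _))) /(_ y isT) /eqP.
  by rewrite expf_eq0 normr_eq0 /= => /eqP.
have : retr s = 0 by rewrite /retr ent_tr big1 // => x _; rewrite s0.
by rewrite s1 => /eqP; rewrite oner_eq0.
Qed.

Lemma invn_complex (N : nat) : (N%:R^-1 : R[i]) = (N%:R^-1 : R)%:C%C.
Proof. by rewrite fmorphV rmorph_nat. Qed.

(* 2 tr(AB) <= tr(A^2) + tr(B^2) bounds the cross terms from above. *)
Lemma Pur_average Q (I : finType) (P : pred I) (F : I -> op R Q) (s r : op R Q) :
  psd s -> (0 < #|P|)%N ->
  (forall i, P i -> exists2 u : op R Q, u \is unitarymx & F i = conj_by u s) ->
  r = #|P|%:R^-1 *: \sum_(i | P i) F i ->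
  #|P|%:R^-1 * Pur s <= Pur r <= Pur s.
Proof.
move=> ps P0 FE ->.
have pF i : P i -> psd (F i) by move=> /FE[u _ ->]; apply: psd_conj.
have PF i : P i -> Pur (F i) = Pur s by move=> /FE[u uu ->]; apply: Pur_conj.
have FF0 i j : P i -> P j -> 0 <= retr (F i *m F j).
  by move=> Pi Pj; apply: retr_psd_mul_ge0; apply: pF.
have FF1 i j : P i -> P j -> retr (F i *m F j) <= Pur s.
  move=> Pi Pj; have : 0 <= Pur (F i - F j).
    by apply: retr_sqr_ge0; rewrite adjD adjN !psd_adj //; apply: pF.
  rewrite /Pur mulmxBl !mulmxBr !retrD !retrN !retrD !retrN.
  by have := PF _ Pi; have := PF _ Pj; rewrite /Pur (retr_mulC (F j)); lra.
have N0 : 0 < #|P|%:R :> R by rewrite ltr0n.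
have -> : Pur (#|P|%:R^-1 *: \sum_(i | P i) F i) =
    #|P|%:R^-1 * (#|P|%:R^-1 *
      \sum_(i | P i) \sum_(j | P j) retr (F i *m F j)).
  rewrite /Pur -scalemxAl -scalemxAr invn_complex !retrZ.
  rewrite mulmx_suml retr_sum; do 2 congr (_ * _); apply: eq_bigr => i _.
  by rewrite mulmx_sumr retr_sum.
apply/andP; split.
  rewrite ler_pM2l ?invr_gt0 // ler_pdivlMl //.
  rewrite mulr_natl -sumr_const.
  (* From each row only the diagonal term is kept; the other terms are nonnegative. *)
  apply: ler_sum => i Pi; rewrite (bigD1 i) //= -(PF _ Pi) lerDl.
  by apply: sumr_ge0 => j /andP[Pj _]; apply: FF0.
rewrite !ler_pdivrMl // !mulr_natl -sumr_const.
apply: ler_sum => i Pi; rewrite -sumr_const.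
by apply: ler_sum => j Pj; apply: FF1.
Qed.

End Purity.

(** * Doped circuits and the state rho *)

Section DopedCircuits.
Variables (R : realType) (Q : finType).
Implicit Types (U C W s : op R Q) (A Y : {set Q}).

Lemma Tgate_unitary (q : Q) : Tgate R q \is unitarymx.
Proof.
apply/unitarymxP; apply: op_ext => x y; rewrite ent_mul ent1.
under eq_bigr do rewrite ent_adj !entE.
pose c (x : bits Q) : R[i] := if x q then (1 + 'i) / sqrtC 2 else 1.
transitivity (\sum_z (z == x)%:R * ((y == z)%:R * (c x * (c y)^*))).
  apply: eq_bigr => z _; rewrite [z == x]eq_sym.
  case: (x == z); last by rewrite !mul0r.
  by case: (y == z); rewrite ?rmorph0 ?mulr0 ?mul0r ?mul1r.
rewrite sum_delta [y == x]eq_sym; have [->|] := eqVneq x y; last first.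
  by rewrite mul0r.
rewrite mul1r /c; case: (y q); last by rewrite rmorph1 mulr1.
have s2 : (sqrtC 2 : R[i])^* = sqrtC 2.
  by rewrite conj_Creal // ger0_real // sqrtC_ge0 ler0n.
rewrite rmorphM /= fmorphV /= s2 rmorphD /= rmorph1 conjCi mulrACA -invfM.
have -> : (1 + 'i) * (1 - 'i) = 2 :> R[i] by have i2 := imaginary_mul R; ring: i2.
by rewrite -expr2 sqrtCK mulfV // pnatr_eq0.
Qed.

Lemma doped_unitary t C : doped t C -> C \is unitarymx.
Proof.
elim=> [U [] //|k U q D [uU _] _ uD].
exact: (mul_unitarymx (mul_unitarymx uU (Tgate_unitary q)) uD).
Qed.

Lemma ent_permop (pi : {perm Q}) x y :
  ent (permop R pi) x y = (y == [ffun q => x (pi q)])%:R.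
Proof.
rewrite entE; congr (nat_of_bool _)%:R; apply/forallP/eqP => [xy|-> q].
  by apply/ffunP => q; rewrite ffunE; apply/esym/eqP.
by rewrite ffunE.
Qed.

Lemma ent_conj_permop (pi : {perm Q}) s x y :
  ent (conj_by (permop R pi) s) x y =
  ent s [ffun q => x (pi q)] [ffun q => y (pi q)].
Proof.
rewrite ent_conj.
transitivity (\sum_u (u == [ffun q => x (pi q)])%:R *
    \sum_v (v == [ffun q => y (pi q)])%:R * ent s u v).
  apply: eq_bigr => u _; rewrite mulr_sumr; apply: eq_bigr => v _.
  by rewrite !ent_permop rmorph_nat mulrA mulrAC.
by rewrite !sum_delta.
Qed.

Lemma permop_unitary (pi : {perm Q}) : permop R pi \is unitarymx.
Proof.
apply/unitarymxP; transitivity (conj_by (permop R pi) 1%:M).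
  by rewrite /conj_by mulmx1.
apply: op_ext => x y; rewrite ent_conj_permop !ent1.
congr (nat_of_bool _)%:R; apply/eqP/eqP => [/ffunP xy|->//].
by apply/ffunP => q; have := xy (pi^-1 q)%g; rewrite !ffunE permKV.
Qed.

(** Conjugation by a qubit permutation only permutes the tensor factors of a Pauli string. *)
Lemma clifford_permop (pi : {perm Q}) : clifford (permop R pi).
Proof.
split; first exact: permop_unitary.
move=> _ [k [p ->]]; exists k, [ffun q => p (pi^-1 q)%g].
rewrite conj_byZ; congr (_ *: _); apply: op_ext => x y.
rewrite ent_conj_permop !entE [RHS](reindex_inj (@perm_inj _ pi)) /=.
by apply: eq_bigr => q _; rewrite !ffunE permK.
Qed.

Lemma conj_permop_acts_only_on (pi : {perm Q}) (S : {set Q}) Y U :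
  pi @: S = Y -> acts_only_on S U -> acts_only_on Y (conj_by (permop R pi) U).
Proof.
move=> piS [u ->]; have piY q : (pi q \in Y) = (q \in S).
  by rewrite -piS mem_imset //; apply: perm_inj.
(* Pulls an assignment on [Y] back to [S] along [pi]. The filling by [false] off [Y] is never read,
   because [pi] maps [S] into [Y]. *)
pose back (a : bits (subreg Y)) : bits (subreg S) :=
  rst S [ffun q => glue a [ffun=> false] (pi q)].
have backE (x : bits Q) : rst S [ffun q => x (pi q)] = back (rst Y x).
  apply/eqP/rst_eqP => q qS; rewrite !ffunE; case: insubP => [v _ vE|].
    by rewrite ffunE vE.
  by rewrite piY qS.
exists (mkop (fun a b => ent u (back a) (back b))).
apply: op_ext => x y; rewrite ent_conj_permop [LHS]entE [RHS]entE entE !ent1.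
rewrite -!backE; congr (_ * (nat_of_bool _)%:R).
apply/rst_eqP/rst_eqP => xy q; last first.
  by rewrite inE -piY => qS; rewrite !ffunE xy // inE.
rewrite inE -(permKV pi q) piY => qS.
by have := xy (pi^-1 q)%g; rewrite !inE !ffunE => ->.
Qed.

(** List each set followed by its complement; matching the two lists position by position gives the
    permutation. *)
Lemma perm_of_card (S Y : {set Q}) : #|S| = #|Y| ->
  exists pi : {perm Q}, pi @: S = Y.
Proof.
move=> SY; pose e (X : {set Q}) := enum X ++ enum (~: X).
have me X q : q \in e X by rewrite mem_cat !mem_enum inE orbN.
have ue X : uniq (e X).
  rewrite cat_uniq !enum_uniq andbT /=; apply/hasPn => q.
  by rewrite /= !mem_enum inE.
have se X : size (e X) = #|Q| by rewrite size_cat -!cardE cardsC.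
(* The default [q] is never returned, since the index is always in range. *)
pose f q := nth q (e Y) (index q (e S)).
have lt_index q : (index q (e S) < size (e Y))%N.
  by rewrite se -(se S) index_mem.
have f_inj : injective f.
  move=> q r; rewrite /f (set_nth_default r) // => /eqP.
  rewrite nth_uniq // => /eqP qr.
  by rewrite -(nth_index r (me S q)) qr nth_index.
exists (perm f_inj); apply/eqP; rewrite eqEcard card_imset ?SY ?leqnn ?andbT.
  apply/fintype.subsetP => _ /imsetP[q qS ->]; rewrite permE /f nth_cat.
  have lt_q : (index q (e S) < size (enum Y))%N.
    by rewrite index_cat mem_enum qS -cardE -SY cardE index_mem mem_enum.
  by rewrite lt_q -mem_enum mem_nth.
exact: perm_inj.
Qed.

Lemma marg_acts_only_on Y U s : U \is unitarymx -> acts_only_on Y U ->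
  marg (~: Y) (conj_by U s) = marg (~: Y) s.
Proof.
move=> + [u UE]; rewrite UE => /unitary_tens1 uu.
by rewrite margC_conj // conj_by1.
Qed.

Lemma rho_twirl C Y W :
  rho C Y W = conj_by (W^t*) (twirl Y (conj_by W (psi C))).
Proof. by rewrite /rho twirlE. Qed.

Lemma clifford_is_W t C Y W : is_W t C Y W -> clifford W.
Proof.
move=> [D [V [c [S [pi [[[cD _ _] _ _ _] _ ->]]]]]].
exact/clifford_mul/cD/clifford_permop.
Qed.

(** With P the permutation and P' its inverse, this is W C = c' W V, where c' = P c P' is supported
    on Y. *)
Lemma mulmx_sandwich n (P P' c D D' V : 'M[R[i]]_n) :
  P' *m P = 1%:M -> D *m D' = 1%:M ->
  P *m D *m (D' *m c *m D *m V) = (P *m c *m P') *m (P *m D *m V).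
Proof.
move=> PP DD; rewrite !mulmxA -(mulmxA P D D') DD mulmx1.
by rewrite -(mulmxA (P *m c) P' P) PP mulmx1.
Qed.

Lemma stabilizer_rho t C Y W : is_W t C Y W -> stabilizer_state (rho C Y W).
Proof.
move=> CW; have cW := clifford_is_W CW; move: CW.
move=> [D [V [c [S [pi [[[cD cV dc] _ _ CE] cY WE]]]]]].
have uc : conj_by (permop R pi) c \is unitarymx.
  by apply: conj_unitary; [apply: permop_unitary|apply: doped_unitary dc].
have WpsiE : conj_by W (psi C) =
    conj_by (conj_by (permop R pi) c) (conj_by (W *m V) (ket0 R Q)).
  rewrite /psi -(conj_byM W C) -(conj_byM _ (W *m V)).
  congr (conj_by _ _); have [_ TT] := unitaryP (permop_unitary pi).
  have [DD _] := unitaryP (clifford_unitary cD).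
  by rewrite CE WE; apply: mulmx_sandwich.
(* The twirl is turned into a partial trace, which discards c', and then back into a twirl, now of a
   stabilizer state. *)
rewrite rho_twirl WpsiE twirlE marg_acts_only_on // -twirlE.
apply: stabilizer_conj; first exact: clifford_adj.
apply/stabilizer_twirl/stabilizer_conj/stabilizer_ket0.
exact: clifford_mul.
Qed.

Lemma pauli_tens A (r : {ffun Q -> bool * bool}) :
  pauli R r = tens (pauli R [ffun q : subreg A => r (val q)])
                   (pauli R [ffun q : subreg (~: A) => r (val q)]).
Proof.
apply: op_ext => x y; rewrite !entE (bigID (mem A)) /=; congr (_ * _).
  by rewrite big_sub; apply: eq_bigr => q _; rewrite !ffunE.
rewrite (eq_bigl (mem (~: A))); last by move=> q; rewrite /= !inE.
by rewrite big_sub; apply: eq_bigr => q _; rewrite !ffunE.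
Qed.

(** The phase cancels against its conjugate. A Pauli string is a product across any bipartition, and
    its factor on the complement disappears in the partial trace. *)
Lemma marg_conj_pauli A g s : pauli_group g ->
  exists2 u, u \is unitarymx & marg A (conj_by g s) = conj_by u (marg A s).
Proof.
move=> [k [r ->]]; rewrite conjZ_by imaginary_expM_conj scale1r (pauli_tens A).
exists (pauli R [ffun q : subreg A => r (val q)]); first exact: pauli_unitary.
by rewrite marg_conj // pauli_unitary.
Qed.

Lemma margZ A c s : marg A (c *: s) = c *: marg A s.
Proof.
apply: op_ext => x y; rewrite entZ !ent_marg mulr_sumr.
by apply: eq_bigr => b _; rewrite entZ.
Qed.

Lemma marg_sum A (I : finType) (P : pred I) (F : I -> op R Q) :
  marg A (\sum_(i | P i) F i) = \sum_(i | P i) marg A (F i).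
Proof.
apply: op_ext => x y; rewrite ent_sum ent_marg.
under eq_bigr do rewrite ent_sum.
by rewrite exchange_big; apply: eq_bigr => i _; rewrite ent_marg.
Qed.

Lemma psd_psi C : psd (psi C).
Proof. exact/psd_conj/psd_ket0. Qed.

Lemma card_paulis_on_nat Y : #|paulis_on Y| = (4 ^ #|Y|)%N.
Proof.
apply/eqP; rewrite -(eqr_nat R[i]) natrX -card_paulis_on -sum1_card natr_sum.
by apply/eqP; apply: eq_bigr.
Qed.

(* rho averages psi over the Paulis W^+ P W, P supported on Y, and every Pauli
   operator is a product for the bipartition A | ~: A. *)
Lemma Pur_marg_rho A Y t C W : is_W t C Y W ->
  (4 ^ #|Y|)%:R^-1 * Pur (marg A (psi C)) <= Pur (marg A (rho C Y W))
    <= Pur (marg A (psi C)).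
Proof.
move=> /clifford_is_W cW; rewrite -card_paulis_on_nat.
apply: (@Pur_average _ _ _ _ (fun p =>
  marg A (conj_by (conj_by (W^t*) (pauli R p)) (psi C)))).
- exact/psd_marg/psd_psi.
- by rewrite card_paulis_on_nat expn_gt0.
- move=> p _; apply: marg_conj_pauli; apply: (clifford_adj cW).2.
  by exists 0%N, p; rewrite scale1r.
rewrite rho_twirl /twirl conj_byZ margZ card_paulis_on_nat natrX.
congr (_ *: _); rewrite conj_by_sum marg_sum; apply: eq_bigr => p _.
by rewrite /conj_by !adj_mul trmxCK !mulmxA.
Qed.

Lemma ent_psi C x y : ent (psi C) x y =
  ent C x [ffun=> false] * (ent C y [ffun=> false])^*.
Proof.
rewrite ent_conj; pose z : bits Q := [ffun=> false].
transitivity (\sum_u (u == z)%:R *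
  \sum_v (v == z)%:R * (ent C x u * (ent C y v)^*)); last by rewrite !sum_delta.
apply: eq_bigr => u _; rewrite mulr_sumr; apply: eq_bigr => v _.
by rewrite ent_ket0; ring.
Qed.

Lemma Pur_margC A C : Pur (marg (~: A) (psi C)) = Pur (marg A (psi C)).
Proof.
rewrite /Pur /retr; congr complex.Re; rewrite !ent_tr.
pose v := fun a b => ent C (glue (A := A) a b) [ffun=> false].
(* With v the matrix of amplitudes of the pure state, the marginals are v v^+ and the transpose of
   v^+ v; both purities are the same fourfold sum of amplitudes in different orders. *)
transitivity (\sum_b \sum_b' \sum_a \sum_a'
  v a b * (v a b')^* * (v a' b' * (v a' b)^*)).
  apply: eq_bigr => b _; rewrite ent_mul; apply: eq_bigr => b' _.
  rewrite !ent_margC big_distrlr /=.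
  by apply: eq_bigr => a _; apply: eq_bigr => a' _; rewrite !ent_psi.
transitivity (\sum_a \sum_a' \sum_b \sum_b'
  v a b * (v a' b)^* * (v a' b' * (v a b')^*)); last first.
  apply: eq_bigr => a _; rewrite ent_mul; apply: eq_bigr => a' _.
  rewrite !ent_marg big_distrlr /=.
  by apply: eq_bigr => b _; apply: eq_bigr => b' _; rewrite !ent_psi.
under eq_bigr do rewrite exchange_big.
rewrite exchange_big; apply: eq_bigr => a _ /=.
under eq_bigr do rewrite exchange_big.
rewrite exchange_big; apply: eq_bigr => a' _ /=.
by apply: eq_bigr => b _; apply: eq_bigr => b' _; ring.
Qed.

(** Whichever side is selected, the bounds are those for [Pur_marg_rho], and by [Pur_margC] they can
    be expressed through side [E]. *)
Lemma purX_bounds E Y t C W : is_W t C Y W ->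
  (4 ^ #|Y|)%:R^-1 * Pur (marg E (psi C)) <= purX E (rho C Y W)
    <= Pur (marg E (psi C)).
Proof.
move=> CW; rewrite /purX /purer_side; case: ifP => _.
  exact: Pur_marg_rho CW.
by rewrite -Pur_margC; apply: Pur_marg_rho CW.
Qed.

Lemma Pur_psi_gt0 E t C : doped t C -> 0 < Pur (marg E (psi C)).
Proof.
move=> /doped_unitary uC; apply: Pur_gt0.
  exact/psd_adj/psd_marg/psd_psi.
by rewrite /retr tr_marg tr_conj // tr_ket0.
Qed.

End DopedCircuits.

(** * Protocols *)

Section Protocols.
Variables (R : realType) (Q : finType).
Implicit Types (U s : op R Q).

(** One statement, proved by a single induction, from which vanishing at 0, real homogeneity and
    additivity follow. *)
Lemma run_linear U O (P : O -> Prop) (p : protocol R Q O) (c : R) s r :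
  run U P p (c%:C%C *: s + r) = c * run U P p s + run U P p r.
Proof.
elim: p s r => [out|p IH|K A next IH] s r /=.
- by case: ifP => _; rewrite ?retrD ?retrZ // mulr0 addr0.
- by rewrite conj_byD conj_byZ IH.
rewrite mulr_sumr -big_split; apply: eq_bigr => k _.
by rewrite conj_byD conj_byZ IH.
Qed.

Lemma run0 U O (P : O -> Prop) (p : protocol R Q O) : run U P p 0 = 0.
Proof.
have := run_linear U P p 1 0 0; rewrite scaler0 addr0 mul1r => /eqP.
by rewrite -subr_eq subrr => /eqP.
Qed.

Lemma runZ U O (P : O -> Prop) (p : protocol R Q O) c s :
  run U P p (c%:C%C *: s) = c * run U P p s.
Proof. by rewrite -[c%:C%C *: s]addr0 run_linear run0 addr0. Qed.

Lemma run_sum U O (P : O -> Prop) (p : protocol R Q O) (I : Type) (r : seq I)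
    (F : I -> op R Q) :
  run U P p (\sum_(i <- r) F i) = \sum_(i <- r) run U P p (F i).
Proof.
elim: r => [|i r IH]; first by rewrite !big_nil run0.
by rewrite !big_cons -IH -[F i]scale1r run_linear mul1r scale1r.
Qed.

Lemma run_ge0 U O (P : O -> Prop) (p : protocol R Q O) s :
  psd s -> 0 <= run U P p s.
Proof.
elim: p s => [out|p IH|K A next IH] s ps /=.
- by case: ifP => // _; apply: retr_psd_ge0.
- exact/IH/psd_conj.
- by apply: sumr_ge0 => k _; apply/IH/psd_conj.
Qed.

Fixpoint bind_protocol (O O' : Type) (p : protocol R Q O) (f : O -> protocol R Q O') :
    protocol R Q O' :=
  match p with
  | Output o => f o
  | Query p' => Query (bind_protocol p' f)
  | Defs.Measure K A next => Defs.Measure A (fun k => bind_protocol (next k) f)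
  end.

Lemma wf_bind O O' (p : protocol R Q O) (f : O -> protocol R Q O') :
  wf_protocol p -> (forall o, wf_protocol (f o)) -> wf_protocol (bind_protocol p f).
Proof.
move=> + wf; elim: p => //= K A next IH [kA wn]; split=> // k.
exact: IH.
Qed.

Lemma queries_bind O O' (p : protocol R Q O) (f : O -> protocol R Q O') k :
  (forall o, queries (f o) <= k)%N -> (queries (bind_protocol p f) <= queries p + k)%N.
Proof.
move=> fk; elim: p => [out|p IH|K A next IH] /=; rewrite ?add0n ?addSn //.
apply/bigmax_leqP => i _; apply: leq_trans (IH i) _.
by rewrite leq_add2r; apply: (@leq_bigmax _ (fun i => queries (next i))).
Qed.

(** A leaf with a good output passes on at least the fraction [c] of its weight; the remaining
    leaves contribute nonnegatively. *)
Lemma run_bind U O O' (G : O -> Prop) (P : O' -> Prop) (c : R)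
    (p : protocol R Q O) (f : O -> protocol R Q O') s :
  (forall o r, G o -> psd r -> c * retr r <= run U P (f o) r) -> psd s ->
  c * run U G p s <= run U P (bind_protocol p f) s.
Proof.
move=> fP; elim: p s => [out|p IH|K A next IH] s ps /=.
- case: asboolP => Go; first exact: fP.
  by rewrite mulr0; apply: run_ge0.
- exact/IH/psd_conj.
- by rewrite mulr_sumr; apply: ler_sum => k _; apply/IH/psd_conj.
Qed.

(** Kraus operators |0><k|: a measurement in the computational basis that discards the outcome and
    leaves |0...0>. *)
Definition reset (O : Type) (p : protocol R Q O) : protocol R Q O :=
  Defs.Measure (fun k : 'I_#|bits Q| =>
    mkop (fun x y => (x == [ffun=> false])%:R * (y == enum_val k)%:R)) (fun=> p).

Lemma wf_reset O (p : protocol R Q O) : wf_protocol p -> wf_protocol (reset p).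
Proof.
split=> //; apply: op_ext => x y; rewrite ent_sum sum_enum_rank ent1.
transitivity (\sum_(k : bits Q) (k == x)%:R * (y == k)%:R : R[i]).
  apply: eq_bigr => k _; rewrite ent_mul.
  transitivity (\sum_(z : bits Q) (z == [ffun=> false])%:R *
      ((z == [ffun=> false])%:R * ((k == x)%:R * (y == k)%:R)) : R[i]).
    apply: eq_bigr => z _; rewrite ent_adj !entE enum_rankK rmorphM !rmorph_nat.
    by rewrite [x == k]eq_sym; ring.
  by rewrite sum_delta eqxx mul1r.
by rewrite sum_delta eq_sym.
Qed.

Lemma queries_reset O (p : protocol R Q O) : (queries (reset p) <= queries p)%N.
Proof. exact/bigmax_leqP. Qed.

Lemma psd_diag s x : psd s -> ent s x x = (complex.Re (ent s x x))%:C%C.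
Proof.
move=> ps; have : (ent s x x)^* = ent s x x by rewrite -ent_adj psd_adj.
case: (ent s x x) => a b [/eqP]; rewrite -subr_eq0 -opprD oppr_eq0.
by rewrite -mulr2n mulrn_eq0 /= => /eqP->.
Qed.

(** Outcome k leaves |0><0| with weight <k|s|k>, and these weights add up to the trace. *)
Lemma run_reset U O (P : O -> Prop) (p : protocol R Q O) s : psd s ->
  run U P (reset p) s = retr s * run U P p (ket0 R Q).
Proof.
move=> ps; rewrite /= sum_enum_rank /retr ent_tr Re_sum mulr_suml.
apply: eq_bigr => k _; rewrite -runZ -psd_diag //; congr run.
apply: op_ext => x y; rewrite ent_conj entZ ent_ket0.
transitivity (\sum_u (u == k)%:R * \sum_v (v == k)%:R *
    ((x == [ffun=> false])%:R * (y == [ffun=> false])%:R * ent s u v)).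
  apply: eq_bigr => u _; rewrite mulr_sumr; apply: eq_bigr => v _.
  by rewrite !entE enum_rankK rmorphM !rmorph_nat; ring.
by rewrite !sum_delta mulrC.
Qed.

End Protocols.

(** * Simulating a protocol on a larger register through an isometry J *)

Section Transport.
Variables (R : realType) (Q Q' : finType) (O : Type) (o0 : O).
Variable J : 'M[R[i]]_(#|bits Q'|, #|bits Q|).
Hypothesis JJ : (J^t*) *m J = 1%:M.

Definition carry (s : op R Q) : op R Q' := J *m s *m (J^t*).

(* The additional Kraus operator 1 - J J^+ completes the transported instrument
   and never occurs on states in the range of J. *)
Definition carry_kraus K (A : 'I_K -> op R Q) (k : 'I_K.+1) : op R Q' :=
  if unlift ord0 k is Some j then carry (A j) else 1%:M - J *m (J^t*).

(** The value [o0] only fills the branch of the added outcome [ord0], which has weight zero on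
    carried states. *)
Fixpoint transport (p : protocol R Q O) : protocol R Q' O :=
  match p with
  | Output o => @Output R Q' O o
  | Query p' => Query (transport p')
  | Defs.Measure K A next => Defs.Measure (carry_kraus A) (fun k =>
      if unlift ord0 k is Some j then transport (next j) else @Output R Q' O o0)
  end.

Lemma adj_carry s : (carry s)^t* = carry (s^t*).
Proof. by rewrite /carry !adj_mul trmxCK mulmxA. Qed.

Lemma carryM s r : carry s *m carry r = carry (s *m r).
Proof.
rewrite /carry !mulmxA -(mulmxA (J *m s) (J^t*) J) JJ mulmx1.
by rewrite -!mulmxA.
Qed.

Lemma adj_compl : (1%:M - J *m (J^t*))^t* = 1%:M - J *m (J^t*).
Proof. by rewrite adjD adjN adj1 adj_mul trmxCK. Qed.

Lemma compl_J : (1%:M - J *m (J^t*)) *m J = 0.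
Proof. by rewrite mulmxBl mul1mx -mulmxA JJ mulmx1 subrr. Qed.

Lemma wf_transport p : wf_protocol p -> wf_protocol (transport p).
Proof.
elim: p => //= K A next IH [kA wn]; split; last first.
  by move=> k; case: (unlift ord0 k) => // j; apply: IH.
rewrite /kraus big_ord_recl /carry_kraus unlift_none adj_compl.
rewrite mulmxBr mulmx1 mulmxA compl_J mul0mx subr0.
under eq_bigr => j _ do rewrite liftK adj_carry carryM.
rewrite /carry -mulmx_suml -mulmx_sumr [\sum_(i < K) _](kA : kraus A).
by rewrite mulmx1 subrK.
Qed.

Lemma queries_transport p : (queries (transport p) <= queries p)%N.
Proof.
elim: p => //= K A next IH; apply/bigmax_leqP => k _.
case: (unlift ord0 k) => [j|//]; apply: leq_trans (IH j) _.
exact: (@leq_bigmax _ (fun i => queries (next i))).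
Qed.

Lemma retr_carry s : retr (carry s) = retr s.
Proof. by rewrite /retr /carry mxtrace_mulC mulmxA JJ mul1mx. Qed.

(** The intertwining relation keeps the state in the range of J through every query, and there the
    transported instruments act as the original ones. *)
Lemma run_transport U U' (P : O -> Prop) p s : U' *m J = J *m U ->
  run U' P (transport p) (carry s) = run U P p s.
Proof.
move=> UJ; elim: p s => [out|p IH|K A next IH] s /=.
- by rewrite retr_carry.
- rewrite -IH; congr run; rewrite /conj_by /carry !mulmxA UJ.
  by rewrite -!mulmxA -adj_mul UJ adj_mul.
rewrite big_ord_recl /carry_kraus unlift_none.
rewrite {1}/conj_by adj_compl {1}/carry !mulmxA compl_J !mul0mx.
rewrite run0 add0r; apply: eq_bigr => j _; rewrite liftK -IH; congr run.
by rewrite /conj_by adj_carry !carryM.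
Qed.

End Transport.

(** * Enlarging the ancilla register by qubits in state 0 *)

Section Padding.
Variables (R : realType) (Q Q1 Q2 : finType).

Definition pairb (Q3 : finType) (a : bits Q) (b : bits Q3) : bits (Q + Q3)%type :=
  [ffun q => match q with inl i => a i | inr j => b j end].

Lemma inl_pairb (Q3 : finType) a (b : bits Q3) : inl_bits (pairb a b) = a.
Proof. by apply/ffunP => q; rewrite !ffunE. Qed.

Lemma inr_pairb (Q3 : finType) a (b : bits Q3) : inr_bits (pairb a b) = b.
Proof. by apply/ffunP => q; rewrite !ffunE. Qed.

Lemma pairb_id (Q3 : finType) (x : bits (Q + Q3)%type) :
  pairb (inl_bits x) (inr_bits x) = x.
Proof. by apply/ffunP => -[q|q]; rewrite !ffunE. Qed.

Lemma sum_pairb (V : nmodType) (Q3 : finType) (F : bits (Q + Q3)%type -> V) :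
  \sum_x F x = \sum_a \sum_b F (pairb a b).
Proof.
rewrite pair_big /= (reindex (fun ab => pairb ab.1 ab.2)) //.
exists (fun x => (inl_bits x, inr_bits x)) => [[a b] _|x _] /=.
  by rewrite inl_pairb inr_pairb.
by rewrite pairb_id.
Qed.

Variable iota : Q1 -> Q2.
Hypothesis iota_inj : injective iota.

Definition pad (b : bits Q1) : bits Q2 :=
  [ffun q => if [pick r | iota r == q] is Some r then b r else false].

Lemma pad_inj : injective pad.
Proof.
move=> b c bc; apply/ffunP => r; have /ffunP/(_ (iota r)) := bc.
rewrite !ffunE; case: pickP => [r' /eqP/iota_inj->//|/(_ r)].
by rewrite eqxx.
Qed.

Lemma pad0 : pad [ffun=> false] = [ffun=> false].
Proof. by apply/ffunP => q; rewrite !ffunE; case: pickP => // r _; rewrite ffunE. Qed.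

Definition padb (x : bits (Q + Q1)%type) : bits (Q + Q2)%type :=
  pairb (inl_bits x) (pad (inr_bits x)).

Lemma padb_inj : injective padb.
Proof.
move=> x y xy; rewrite -(pairb_id x) -(pairb_id y).
have := congr1 (@inl_bits _ _) xy; have := congr1 (@inr_bits _ _) xy.
by rewrite !inl_pairb !inr_pairb => /pad_inj-> ->.
Qed.

Definition padmx : 'M[R[i]]_(#|bits (Q + Q2)%type|, #|bits (Q + Q1)%type|) :=
  \matrix_(i, j) (enum_val i == padb (enum_val j))%:R.

Lemma padmx_isometry : (padmx^t*) *m padmx = 1%:M.
Proof.
apply: op_ext => x y; rewrite ent1 /ent mxE sum_enum_rank.
transitivity (\sum_z (z == padb x)%:R * (z == padb y)%:R : R[i]).
  by apply: eq_bigr => z _; rewrite !mxE !enum_rankK rmorph_nat.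
by rewrite sum_delta (inj_eq padb_inj).
Qed.

(** [C] acts on [Q] and the padding on the ancillas, so they commute; this is the intertwining
    relation that [run_transport] asks for. *)
Lemma otimes_padmx (C : op R Q) :
  otimes C (1%:M : op R Q2) *m padmx = padmx *m otimes C (1%:M : op R Q1).
Proof.
apply/matrixP => i j; rewrite !mxE !sum_enum_rank.
pose z := enum_val i; pose x := enum_val j.
transitivity (\sum_w (w == padb x)%:R * ent (otimes C (1%:M : op R Q2)) z w).
  apply: eq_bigr => w _; rewrite [RHS]mulrC; congr (_ * _).
    by rewrite /ent enum_valK.
  by rewrite !mxE enum_rankK.
rewrite sum_delta entE ent1 inl_pairb inr_pairb.
transitivity (\sum_a \sum_b (b == inr_bits x)%:R *
    ((z == pairb a (pad b))%:R * ent C a (inl_bits x))); last first.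
  rewrite sum_pairb; apply: eq_bigr => a _; apply: eq_bigr => b _.
  rewrite !mxE !enum_rankK inl_pairb inr_pairb /padb inl_pairb inr_pairb.
  by rewrite -/(ent _ _ _) ent1 -/z -/x; ring.
under eq_bigr do rewrite sum_delta.
transitivity (\sum_a (a == inl_bits z)%:R *
    ((inr_bits z == pad (inr_bits x))%:R * ent C a (inl_bits x))).
  by rewrite sum_delta mulrC.
apply: eq_bigr => a _; rewrite mulrA -natrM mulnb; congr ((nat_of_bool _)%:R * _).
apply/andP/eqP => [[/eqP-> /eqP<-]|->]; first by rewrite pairb_id.
by rewrite inl_pairb inr_pairb !eqxx.
Qed.

Lemma carry_ket0 : carry padmx (ket0 R (Q + Q1)%type) = ket0 R (Q + Q2)%type.
Proof.
have pb0 : padb [ffun=> false] = [ffun=> false].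
  have r0 : inr_bits ([ffun=> false] : bits (Q + Q1)%type) = [ffun=> false].
    by apply/ffunP => q; rewrite !ffunE.
  by rewrite /padb r0 pad0; apply/ffunP => -[q|q]; rewrite !ffunE.
apply: op_ext => x y; rewrite ent_ket0 /ent mxE sum_enum_rank.
transitivity (\sum_(v : bits (Q + Q1)%type) (v == [ffun=> false])%:R *
    ((x == padb [ffun=> false])%:R * (y == padb v)%:R) : R[i]).
  apply: eq_bigr => v _; rewrite !mxE !enum_rankK rmorph_nat sum_enum_rank.
  transitivity (\sum_(u : bits (Q + Q1)%type) (u == [ffun=> false])%:R *
      ((x == padb u)%:R * (v == [ffun=> false])%:R * (y == padb v)%:R) : R[i]).
    rewrite mulr_suml; apply: eq_bigr => u _.
    by rewrite -/(ent _ _ _) ent_ket0 !mxE !enum_rankK; ring.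
  by rewrite sum_delta; ring.
by rewrite sum_delta pb0.
Qed.

End Padding.

(** * Tensor products over a disjoint union of registers *)

Section TensorProducts.
Variable R : realType.

Lemma ent_otimes (Q1 Q2 : finType) (a : op R Q1) (b : op R Q2) x x' y y' :
  ent (otimes a b) (pairb x y) (pairb x' y') = ent a x x' * ent b y y'.
Proof. by rewrite entE !inl_pairb !inr_pairb. Qed.

Lemma otimes_mul (Q1 Q2 : finType) (a a' : op R Q1) (b b' : op R Q2) :
  otimes a b *m otimes a' b' = otimes (a *m a') (b *m b').
Proof.
apply: op_ext => x y; rewrite -(pairb_id x) -(pairb_id y).
rewrite ent_mul sum_pairb ent_otimes !ent_mul big_distrlr /=.
by apply: eq_bigr => c _; apply: eq_bigr => d _; rewrite !ent_otimes mulrACA.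
Qed.

Lemma otimes_adj (Q1 Q2 : finType) (a : op R Q1) (b : op R Q2) :
  (otimes a b)^t* = otimes (a^t*) (b^t*).
Proof.
apply: op_ext => x y; rewrite ent_adj [in LHS]entE [in RHS]entE rmorphM.
by rewrite !ent_adj.
Qed.

Lemma otimes11 (Q1 Q2 : finType) :
  otimes (1%:M : op R Q1) (1%:M : op R Q2) = 1%:M.
Proof.
apply: op_ext => x y; rewrite entE !ent1 -natrM mulnb.
congr ((nat_of_bool _)%:R); apply/andP/eqP => [[/eqP xy /eqP xy']|->//].
by rewrite -(pairb_id x) xy xy' pairb_id.
Qed.

Lemma otimes_conj (Q1 Q2 : finType) (a u : op R Q1) (b v : op R Q2) :
  conj_by (otimes u v) (otimes a b) = otimes (conj_by u a) (conj_by v b).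
Proof. by rewrite /conj_by otimes_adj !otimes_mul. Qed.

Lemma otimes_suml (Q1 Q2 : finType) (I : Type) (r : seq I) (F : I -> op R Q1)
    (b : op R Q2) :
  otimes (\sum_(i <- r) F i) b = \sum_(i <- r) otimes (F i) b.
Proof.
apply: op_ext => x y; rewrite entE !ent_sum mulr_suml.
by apply: eq_bigr => i _; rewrite entE.
Qed.

Lemma otimes_sumr (Q1 Q2 : finType) (I : Type) (r : seq I) (F : I -> op R Q2)
    (a : op R Q1) :
  otimes a (\sum_(i <- r) F i) = \sum_(i <- r) otimes a (F i).
Proof.
apply: op_ext => x y; rewrite entE !ent_sum mulr_sumr.
by apply: eq_bigr => i _; rewrite entE.
Qed.

Lemma tr_otimes (Q1 Q2 : finType) (a : op R Q1) (b : op R Q2) :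
  \tr (otimes a b) = \tr a * \tr b.
Proof.
rewrite !ent_tr sum_pairb big_distrlr /=.
by apply: eq_bigr => c _; apply: eq_bigr => d _; rewrite ent_otimes.
Qed.

Lemma otimes_ket0 (Q1 Q2 : finType) :
  otimes (ket0 R Q1) (ket0 R Q2) = ket0 R (Q1 + Q2)%type.
Proof.
have sum0 (z : bits (Q1 + Q2)%type) : (inl_bits z == [ffun=> false])%:R
    * (inr_bits z == [ffun=> false])%:R = (z == [ffun=> false])%:R :> R[i].
  rewrite -natrM mulnb; congr ((nat_of_bool _)%:R).
  apply/andP/eqP => [[/eqP zl /eqP zr]|->].
    by rewrite -(pairb_id z) zl zr; apply/ffunP => -[q|q]; rewrite !ffunE.
  by split; apply/eqP/ffunP => q; rewrite !ffunE.
by apply: op_ext => x y; rewrite entE !ent_ket0 mulrACA !sum0.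
Qed.

End TensorProducts.

(** * Preparing k copies of a state with one query for each *)

Section CopyPreparation.
Variables (R : realType) (Q : finType) (k : nat).
Let Anc : finType := ('I_k * Q)%type.
Let Reg : finType := (Q + Anc)%type.

Definition block (x : bits Anc) (j : 'I_k) : bits Q := [ffun q => x (j, q)].

(** Generalizes [copies] to blocks in different states, as they occur while the preparation is under
    way. *)
Definition product_state (a : 'I_k -> op R Q) : op R Anc :=
  mkop (fun x y => \prod_j ent (a j) (block x j) (block y j)).

Lemma product_state_ket0 : product_state (fun=> ket0 R Q) = ket0 R Anc.
Proof.
apply: op_ext => x y; rewrite entE ent_ket0.
have block0 (z : bits Anc) : \prod_j (block z j == [ffun=> false])%:R =
    (z == [ffun=> false])%:R :> R[i].
  have [->|nz] := eqVneq z [ffun=> false].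
    apply: big1 => j _; rewrite (_ : block _ _ = [ffun=> false]) ?eqxx //.
    by apply/ffunP => q; rewrite !ffunE.
  apply/eqP/prodf_eq0; have /existsP[[j q] zq] : [exists q, z q].
    apply: contraNT nz; rewrite negb_exists => /forallP zF.
    by apply/eqP/ffunP => q; rewrite ffunE; apply/negbTE/zF.
  exists j => //; suff /negbTE-> : block z j != [ffun=> false] by [].
  by apply/eqP => /ffunP/(_ q); rewrite !ffunE zq.
rewrite -!block0 -big_split; apply: eq_bigr => j _.
by rewrite ent_ket0.
Qed.

Definition exchange_fun (j : 'I_k) (q : Reg) : Reg :=
  match q with
  | inl i => inr (j, i)
  | inr (j', i) => if j' == j then inl i else inr (j', i)
  end.

Lemma exchange_funK j : involutive (exchange_fun j).
Proof.
by case=> [i|[j' i]] /=; [rewrite eqxx | case: eqVneq => /= [->|/negbTE ->]].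
Qed.

Definition exchange (j : 'I_k) : {perm Reg} := perm (inv_inj (exchange_funK j)).

Lemma conj_exchange j b a :
  conj_by (permop R (exchange j)) (otimes b (product_state a)) =
  otimes (a j) (product_state (fun j' => if j' == j then b else a j')).
Proof.
apply: op_ext => x y; rewrite ent_conj_permop [LHS]entE [RHS]entE !entE.
have inlE (z : bits Reg) :
    inl_bits [ffun q => z (exchange j q)] = block (inr_bits z) j.
  by apply/ffunP => q; rewrite !ffunE permE.
have inrE (z : bits Reg) j' : block (inr_bits [ffun q => z (exchange j q)]) j' =
    if j' == j then inl_bits z else block (inr_bits z) j'.
  apply/ffunP => q; rewrite !ffunE permE /=.
  by case: (j' == j); rewrite !ffunE.
rewrite !inlE (bigD1 j) //= !inrE eqxx [in RHS](bigD1 j) //= eqxx mulrCA.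
congr (_ * (_ * _)); apply: eq_bigr => j' /negbTE nj.
by rewrite !inrE nj.
Qed.

Variables (O : Type) (N M : nat).
Variables (K : 'I_N -> op R Q) (A : 'I_M -> op R Anc) (f : 'I_M -> O).

(* For each j in l: query C on |0>, apply the channel with Kraus operators K,
   and store the result in block j, which returns the |0> kept there. *)
Fixpoint prepare (l : seq 'I_k) : protocol R Reg O :=
  match l with
  | [::] => Defs.Measure (fun m => otimes 1%:M (A m)) (fun m => @Output R Reg O (f m))
  | j :: l' => Query (Defs.Measure (fun i =>
      permop R (exchange j) *m otimes (K i) 1%:M) (fun=> prepare l'))
  end.

Lemma queries_prepare l : (queries (prepare l) <= size l)%N.
Proof.
elim: l => [|j l IH] /=; first exact/bigmax_leqP.
by rewrite ltnS; apply/bigmax_leqP.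
Qed.

Lemma wf_prepare l : kraus K -> kraus A -> wf_protocol (prepare l).
Proof.
move=> kK kA; elim: l => [|j l IH] /=.
  split=> //; rewrite /kraus; under eq_bigr do rewrite otimes_adj otimes_mul.
  by rewrite -otimes_sumr [\sum_(i < M) _](kA : kraus A) adj1 mulmx1 otimes11.
split=> //; have [_ TT] := unitaryP (permop_unitary R (exchange j)).
rewrite /kraus; transitivity (\sum_(i < N) otimes ((K i)^t* *m K i) (1%:M : op R Anc)).
  apply: eq_bigr => i _; rewrite adj_mul mulmxA -(mulmxA _ _ (permop R _)) TT.
  by rewrite mulmx1 otimes_adj otimes_mul adj1 mulmx1.
by rewrite -otimes_suml [\sum_(i < N) _](kK : kraus K) otimes11.
Qed.

Lemma run_prepare (P : O -> Prop) (C s : op R Q) :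
  \sum_i conj_by (K i) (psi C) = s ->
  run (otimes C (1%:M : op R Anc)) P (prepare (enum 'I_k)) (ket0 R Reg) =
  \sum_(m < M) if `[< P (f m) >] then retr (conj_by (A m) (copies k s)) else 0.
Proof.
(* Invariant: when the blocks in [l] are still to be filled, they hold |0>, all other blocks hold
   [s], and the query register is back in |0>. *)
move=> Ks; pose st (l : seq 'I_k) :=
  product_state (fun j => if j \in l then ket0 R Q else s).
have -> : ket0 R Reg = otimes (ket0 R Q) (st (enum 'I_k)).
  rewrite -otimes_ket0 -product_state_ket0; congr (otimes _ _).
  apply: op_ext => x y; rewrite !entE; apply: eq_bigr => j _.
  by rewrite mem_enum.
elim: (enum 'I_k) (enum_uniq 'I_k) => [_|j l IH /andP[jl ul]] /=.
  apply: eq_bigr => m _; case: ifP => // _.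
  by rewrite otimes_conj /retr tr_otimes conj_by1 tr_ket0 mul1r.
rewrite otimes_conj conj_by1 -/(psi C) -IH // -run_sum; congr run.
under eq_bigr do rewrite conj_byM otimes_conj conj_by1.
rewrite -conj_by_sum -otimes_suml Ks conj_exchange mem_head.
congr (otimes _ _); apply: op_ext => x y; rewrite !entE.
apply: eq_bigr => j' _; rewrite inE.
by case: eqVneq => //= ->; rewrite (negbTE jl).
Qed.

End CopyPreparation.

(** * The complete protocol: learn D, prepare copies of rho, learn rho *)

Section LearningProtocol.
Variables (R : realType) (n : nat).

Lemma sum_enum_val (V : nmodType) (T : finType) (F : T -> V) :
  \sum_(i < #|T|) F (enum_val i) = \sum_x F x.
Proof. by rewrite sum_enum_rank; apply: eq_bigr => x _; rewrite enum_rankK. Qed.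

(** The channel sending psi to rho. The amplitude 2^-|Y| squares to the twirl weight 4^-|Y|; labels
    not supported on [Y] get the zero operator, so that all labels can serve as outcomes. *)
Definition twirl_kraus (Y : {set 'I_n}) (W : op R 'I_n)
    (i : 'I_#|{: {ffun 'I_n -> bool * bool}}|) : op R 'I_n :=
  if paulis_on Y (enum_val i)
  then (2 ^+ #|Y|)^-1 *: conj_by (W^t*) (pauli R (enum_val i)) else 0.

Lemma inv2X_conj m : (2 ^+ m)^-1 * ((2 ^+ m)^-1)^* = (4 ^+ m)^-1 :> R[i].
Proof.
rewrite fmorphV rmorphXn /= rmorph_nat -invfM -exprMn.
by congr ((_ ^+ _)^-1); ring.
Qed.

Lemma conj_twirl_kraus Y W s i :
  conj_by (twirl_kraus Y W i) s =
  if paulis_on Y (enum_val i) then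
    (4 ^+ #|Y|)^-1 *: conj_by (W^t*) (conj_by (pauli R (enum_val i)) (conj_by W s))
  else 0.
Proof.
rewrite /twirl_kraus.
case: (paulis_on _ _); last by rewrite /conj_by mul0mx mul0mx.
by rewrite conjZ_by inv2X_conj /conj_by !adj_mul trmxCK !mulmxA.
Qed.

Lemma sum_twirl_kraus Y W C :
  \sum_i conj_by (twirl_kraus Y W i) (psi C) = rho C Y W.
Proof.
rewrite rho_twirl /twirl conj_byZ conj_by_sum scaler_sumr.
rewrite [RHS]big_mkcond -[RHS]sum_enum_val.
by apply: eq_bigr => i _; exact: conj_twirl_kraus.
Qed.

Lemma kraus_twirl Y W : W \is unitarymx -> kraus (twirl_kraus Y W).
Proof.
move=> uW; rewrite /kraus.
transitivity ((4 ^+ #|Y|)^-1 *: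
    \sum_(p | paulis_on Y p) 1 *: (1%:M : op R 'I_n)).
  rewrite scaler_sumr [RHS]big_mkcond -[RHS]sum_enum_val; apply: eq_bigr => i _.
  rewrite /twirl_kraus; case: ifP => _; last by rewrite mulmx0.
  rewrite adjZ -scalemxAl -scalemxAr scalerA [_^* * _]mulrC inv2X_conj.
  have /unitaryP[_ ->] := conj_unitary (unitary_adj uW)
    (pauli_unitary R (enum_val i)).
  by rewrite scale1r.
by rewrite -scaler_suml card_paulis_on scalerA mulVf ?scale1r.
Qed.

Lemma embed_protocol (QA : finType) m O (o0 : O)
    (p : protocol R ('I_n + QA)%type O) :
  (#|QA| <= m)%N -> wf_protocol p ->
  exists p' : query_protocol R n m O,
    [/\ wf_protocol p', (queries p' <= queries p)%N
      & forall (C : op R 'I_n) (P : O -> Prop), success p' C P =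
          run (otimes C (1%:M : op R QA)) P p (ket0 R ('I_n + QA)%type)].
Proof.
move=> QAm wp; pose iota (q : QA) : 'I_m := widen_ord QAm (enum_rank q).
have iota_inj : injective iota.
  by move=> q r /(congr1 val)/= /val_inj/enum_rank_inj.
pose J := padmx R 'I_n iota.
have JJ : (J^t*) *m J = 1%:M by apply: padmx_isometry.
exists (transport o0 J p); split.
- exact: wf_transport.
- exact: queries_transport.
- move=> C P; rewrite /success -(carry_ket0 R 'I_n iota).
  by apply: run_transport => //; apply: otimes_padmx.
Qed.

(** The permutation depends only on [S] and [Y], so one [W] serves every circuit diagonalized by [D]
    with subsystem [S], and can be computed from what has been learned. *)
Lemma W_of_diagonalizer t (Y S : {set 'I_n}) (D : op R 'I_n) : #|Y| = t ->
  exists2 W : op R 'I_n, W \is unitarymx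
    & forall C, diagonalizer t C D S -> is_W t C Y W.
Proof.
move=> Yt; have [[cD St]|nDS] := pselect (clifford D /\ #|S| = t); last first.
  exists 1%:M; first by apply/unitarymxP; rewrite adj1 mulmx1.
  by move=> C [V [c [[cD _ _] St _ _]]]; case: nDS.
have [pi piS] : exists pi : {perm 'I_n}, pi @: S = Y.
  by apply: perm_of_card; rewrite St.
exists (permop R pi *m D).
  exact: (mul_unitarymx (permop_unitary R pi) (clifford_unitary cD)).
move=> C [V [c CDV]]; exists D, V, c, S, pi; split=> //.
by apply: conj_permop_acts_only_on piS _; case: CDV.
Qed.

Lemma learning_protocol t (E Y : {set 'I_n}) m1
    (p1 : query_protocol R n m1 (op R 'I_n * {set 'I_n})) (d1 : R)
    k M (A : 'I_M -> op R ('I_k * 'I_n)%type) (L : 'I_M -> op R 'I_n) (d2 : R) :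
  #|Y| = t -> wf_protocol p1 ->
  (forall C, doped t C ->
     1 - d1 <= success p1 C (fun out => diagonalizer t C out.1 out.2)) ->
  kraus A ->
  (forall s, stabilizer_state s ->
     1 - d2 <= \sum_(i < M | L i == s) retr (conj_by (A i) (copies k s))) ->
  exists m (p : query_protocol R n m (op R 'I_n * R)),
    [/\ wf_protocol p, (queries p <= queries p1 + k)%N
      & forall C, doped t C -> 1 - (`|d1| + `|d2|) <=
          success p C (fun out => is_W t C Y out.1 /\
                                  out.2 = purX E (rho C Y out.1))].
Proof.
(* Enough ancillas for either stage; the register is reset between the two. *)
move=> Yt wp1 p1P kA AP; pose m := (m1 + k * n)%N; exists m.
have /choice[W WP] (out : op R 'I_n * {set 'I_n}) : exists W : op R 'I_n,
    W \is unitarymx /\ forall C, diagonalizer t C out.1 out.2 -> is_W t C Y W.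
  by have [W uW WP] := W_of_diagonalizer out.2 out.1 Yt; exists W.
pose prep out := prepare (twirl_kraus Y (W out)) A
  (fun i => (W out, purX E (L i))) (enum 'I_k).
have kn_m : (#|{: 'I_k * 'I_n}| <= m)%N by rewrite card_prod !card_ord leq_addl.
have m1_m : (#|'I_m1| <= m)%N by rewrite card_ord leq_addr.
have wf_prep out : wf_protocol (prep out).
  by apply: wf_prepare => //; apply/kraus_twirl/(WP out).1.
have /choice[p2 p2P] out := embed_protocol ((0, 0) : op R 'I_n * R) kn_m (wf_prep out).
have [p1' [wp1' qp1 p1'P]] :=
  embed_protocol ((0, finset.set0) : op R 'I_n * {set 'I_n}) m1_m wp1.
exists (bind_protocol p1' (fun out => reset (p2 out))); split.
- by apply: wf_bind => // out; apply: wf_reset; case: (p2P out).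
- apply: (leq_trans (queries_bind _ (k := k) _)); last by rewrite leq_add2r.
  move=> out; apply: leq_trans (queries_reset _) _.
  have [_ q2 _] := p2P out; apply: leq_trans q2 _.
  by apply: leq_trans (queries_prepare _ _ _ _) _; rewrite size_enum_ord.
move=> C dC; pose P (out : op R 'I_n * R) :=
  is_W t C Y out.1 /\ out.2 = purX E (rho C Y out.1).
rewrite -/P.
have s_ge0 : 0 <= success (bind_protocol p1' (fun out => reset (p2 out))) C P.
  exact/run_ge0/psd_ket0.
(* For |d2| > 1 the claimed bound is negative; otherwise 1 - |d2| may be used as a nonnegative
   factor. *)
have [d2_gt1|d2_le1] := ltP 1 `|d2|.
  by have := normr_ge0 d1; lra.
have s1 := p1P C dC; rewrite -[success p1 C _](p1'P C) in s1.
have : (1 - `|d2|) * success p1' C (fun out => diagonalizer t C out.1 out.2)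
       <= success (bind_protocol p1' (fun out => reset (p2 out))) C P.
  apply: run_bind; last exact: psd_ket0.
  move=> out r /(WP out).2 CW pr; rewrite run_reset // mulrC.
  apply: ler_wpM2l; first exact: retr_psd_ge0.
  have [_ _ p2E] := p2P out; rewrite -/(success (p2 out) C P) p2E.
  have Ks := sum_twirl_kraus Y (W out) C.
  rewrite (run_prepare A _ P Ks).
  (* This weight is the probability that the same preparation, decoded by [id], outputs [i]. *)
  have r_ge0 i : 0 <= retr (conj_by (A i) (copies k (rho C Y (W out)))).
    have := run_ge0 (otimes C 1%:M) (fun i' => i' = i)
      (prepare (twirl_kraus Y (W out)) A id (enum 'I_k)) (psd_ket0 R _).
    rewrite (run_prepare A _ _ Ks) (bigD1 i) //= asboolT // big1 ?addr0 //.
    by move=> i' /eqP ni; rewrite asboolF.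
  have := AP _ (stabilizer_rho CW); have := ler_norm d2.
  suff : \sum_(i < M | L i == rho C Y (W out))
      retr (conj_by (A i) (copies k (rho C Y (W out)))) <=
    \sum_(i < M) if `[< P (W out, purX E (L i)) >]
      then retr (conj_by (A i) (copies k (rho C Y (W out)))) else 0 by lra.
  rewrite big_mkcond; apply: ler_sum => i _; case: eqP => [Li|_].
    have PLi : P (W out, purX E (L i)) by rewrite Li; exact: (conj CW (erefl _)).
    by rewrite (asboolT PLi).
  by case: ifP.
(* Uses (1 - |d1|)(1 - |d2|) >= 1 - |d1| - |d2|. *)
have := ler_norm d1; have := normr_ge0 d1; have := normr_ge0 d2.
move: s1; set s1 := success p1' _ _; set s2 := success _ _ _; nra.
Qed.

End LearningProtocol.

(** * The swap test *)

Section SwapTest.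
Variables (R : realType) (Q : finType).
Implicit Types s : op R Q.

Lemma psd_otimes (Q1 Q2 : finType) (a : op R Q1) (b : op R Q2) :
  psd a -> psd b -> psd (otimes a b).
Proof.
move=> [k [B ->]] [l [C ->]].
pose D : 'M[R[i]]_(#|bits (Q1 + Q2)%type|, #|{: 'I_k * 'I_l}|) :=
  \matrix_(i, j) (B (enum_rank (inl_bits (enum_val i))) (enum_val j).1 *
                  C (enum_rank (inr_bits (enum_val i))) (enum_val j).2).
exists _, D; apply: op_ext => x y.
rewrite entE {3}/ent mxE sum_enum_rank /ent !mxE big_distrlr /= pair_bigA.
apply: eq_bigr => p _; rewrite !mxE !enum_rankK rmorphM; ring.
Qed.

Lemma swapop_adj : (swapop R Q)^t* = swapop R Q.
Proof.
apply: op_ext => x y; rewrite ent_adj !entE rmorph_nat andbC.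
by rewrite [inr_bits y == _]eq_sym [inl_bits y == _]eq_sym.
Qed.

Lemma sum_swapop (x : bits (Q + Q)%type) (F : bits (Q + Q)%type -> R[i]) :
  \sum_z ent (swapop R Q) x z * F z = F (pairb (inr_bits x) (inl_bits x)).
Proof.
rewrite -[RHS]sum_delta; apply: eq_bigr => z _; rewrite entE.
congr ((nat_of_bool _)%:R * _); apply/andP/eqP => [[/eqP xz /eqP zx]|->].
  by rewrite xz zx pairb_id.
by rewrite inl_pairb inr_pairb.
Qed.

Lemma swapop_sqr : swapop R Q *m swapop R Q = 1%:M.
Proof.
apply: op_ext => x y; rewrite ent_mul sum_swapop entE ent1.
rewrite inl_pairb inr_pairb; congr ((nat_of_bool _)%:R).
apply/andP/eqP => [[/eqP xr /eqP xl]|->//].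
by rewrite -(pairb_id x) xr xl pairb_id.
Qed.

(** The swap trick: SWAP crosses the indices of the two copies, which turns the trace of a tensor
    product into that of a matrix product. *)
Lemma tr_swapop s : \tr (swapop R Q *m otimes s s) = \tr (s *m s).
Proof.
rewrite !ent_tr sum_pairb exchange_big; apply: eq_bigr => b _ /=.
rewrite ent_mul; apply: eq_bigr => a _.
by rewrite ent_mul sum_swapop inl_pairb inr_pairb ent_otimes.
Qed.

Lemma retr_signZ (Q' : finType) (b : bool) (A : op R Q') :
  retr ((-1) ^+ b *: A) = (-1) ^+ b * retr A.
Proof. by case: b; rewrite ?expr0 ?scale1r ?mul1r // expr1 scaleN1r retrN mulN1r. Qed.

Lemma swap_probE s b : \tr s = 1 ->
  swap_prob s b = (1 + (-1) ^+ b * Pur s) / 2.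
Proof.
move=> s1; rewrite /swap_prob -scalemxAl invn_complex retrZ mulrC.
rewrite mulmxDl mul1mx retrD -scalemxAl retr_signZ; congr ((_ + _ * _) * _).
  by rewrite /retr tr_otimes s1 mulr1.
by rewrite /retr tr_swapop.
Qed.

Lemma swap_prob_ge0 s b : psd s -> 0 <= swap_prob s b.
Proof.
(* (1 + (-1)^b SWAP) / 2 is an orthogonal projection. *)
move=> ps; rewrite /swap_prob; set P := _ *: _.
have adjP : P^t* = P.
  rewrite /P adjZ adjD adjZ adj1 swapop_adj fmorphV rmorph_nat.
  by rewrite rmorphXn /= rmorphN1.
have PP : P *m P = P.
  rewrite /P; move: (swapop R Q) swapop_sqr => S SS.
  rewrite -scalemxAl -scalemxAr; congr (_ *: _).
  rewrite mulmxDr mulmx1 -scalemxAr mulmxDl mul1mx -scalemxAl SS.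
  rewrite [(-1) ^+ b *: (_ + _)]scalerDr scalerA -expr2 sqrr_sign scale1r.
  rewrite [_ *: S + 1%:M]addrC.
  rewrite scalerDr -scalerDl (_ : 2^-1 + 2^-1 = 1) ?scale1r //.
  by field.
rewrite -PP -mulmxA retr_mulC -{2}adjP.
exact/retr_psd_ge0/psd_conj/psd_otimes.
Qed.

Lemma sum_outcomes (M : nat) (F : 'I_M -> bool -> R) :
  \sum_(o : {ffun 'I_M -> bool}) \prod_j F j (o j) = \prod_j \sum_b F j b.
Proof. by rewrite bigA_distr_bigA. Qed.

(** The variance of a sum of independent centred variables: the cross terms vanish and M equal
    variances remain. *)
Lemma sum_outcomes_sqr (M : nat) (p f : bool -> R) (v : R) :
  \sum_b p b = 1 -> \sum_b p b * f b = 0 -> \sum_b p b * f b ^+ 2 = v ->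
  \sum_(o : {ffun 'I_M -> bool}) (\prod_j p (o j)) * (\sum_j f (o j)) ^+ 2
  = M%:R * v.
Proof.
move=> p1 f0 f2.
have prod1 (i : 'I_M) (g : 'I_M -> R) :
    \prod_k (if k == i then g k else 1) = g i.
  by rewrite -big_mkcond big_pred1_eq.
have cross (i j : 'I_M) : \sum_(o : {ffun 'I_M -> bool})
    (\prod_k p (o k)) * (f (o i) * f (o j)) = if j == i then v else 0.
  (* The two factors are spread over all positions, with 1 elsewhere, so that the expectation
     factorizes. *)
  transitivity (\sum_(o : {ffun 'I_M -> bool}) \prod_k (p (o k)
      * ((if k == i then f (o k) else 1) * (if k == j then f (o k) else 1)))).
    apply: eq_bigr => o _; rewrite !big_split /=.
    by rewrite (prod1 i (fun k => f (o k))) (prod1 j (fun k => f (o k))).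
  rewrite (sum_outcomes (fun k b => p b *
    ((if k == i then f b else 1) * (if k == j then f b else 1)))).
  case: eqVneq => [->|ji].
    rewrite -[RHS](prod1 i (fun=> v)); apply: eq_bigr => k _.
    case: (k == i); first by rewrite -f2; apply: eq_bigr => b _; rewrite expr2.
    by rewrite -[RHS]p1; apply: eq_bigr => b _; rewrite !mulr1.
  apply/eqP/prodf_eq0; exists i => //; rewrite eqxx [i == j]eq_sym (negbTE ji).
  by rewrite -[X in _ == X]f0; apply/eqP/eq_bigr => b _; rewrite mulr1.
transitivity (\sum_(i < M) \sum_(j < M) if j == i then v else 0).
  under [RHS]eq_bigr do under eq_bigr do rewrite -cross.
  under [RHS]eq_bigr do rewrite exchange_big.
  rewrite exchange_big; apply: eq_bigr => o _.
  rewrite expr2 big_distrlr mulr_sumr; apply: eq_bigr => i _ /=.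
  by rewrite mulr_sumr.
under eq_bigr do rewrite -big_mkcond big_pred1_eq.
by rewrite sumr_const card_ord mulr_natl.
Qed.

Lemma swap_test_chebyshev s (M : nat) (eps : R) :
  psd s -> \tr s = 1 -> (0 < M)%N -> 0 < eps ->
  1 - (M%:R * eps ^+ 2)^-1 <= swap_test_success s M eps.
Proof.
move=> ps s1 M0 eps0; set mu := Pur s.
have M0' : 0 < M%:R :> R by rewrite ltr0n.
have p_ge0 b : 0 <= swap_prob s b by apply: swap_prob_ge0.
have pE b : swap_prob s b = (1 + (-1) ^+ b * mu) / 2 by apply: swap_probE.
pose f (b : bool) : R := (-1) ^+ b - mu.
have p1 : \sum_b swap_prob s b = 1.
  by rewrite big_bool /= !pE expr0 expr1; field.
have f0 : \sum_b swap_prob s b * f b = 0.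
  by rewrite big_bool /= !pE /f expr0 expr1; field.
have f2 : \sum_b swap_prob s b * f b ^+ 2 = 1 - mu ^+ 2.
  by rewrite big_bool /= !pE /f !expr0 !expr1; field.
pose good (o : {ffun 'I_M -> bool}) := `|swap_estimate R o - mu| <= eps.
pose w (o : {ffun 'I_M -> bool}) := \prod_(j < M) swap_prob s (o j).
have w_ge0 o : 0 <= w o by apply: prodr_ge0.
have w1 : \sum_o w o = 1.
  by rewrite (sum_outcomes (fun _ => swap_prob s)) big1.
have estE (o : {ffun 'I_M -> bool}) : swap_estimate R o - mu = (\sum_j f (o j)) / M%:R.
  rewrite /swap_estimate /f sumrB sumr_const card_ord mulrBl.
  by congr (_ - _); rewrite -[mu *+ M]mulr_natr mulfK ?gt_eqF.
have bad : \sum_(o | ~~ good o) w o <= (M%:R * eps ^+ 2)^-1.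
  apply: (@le_trans _ _ (\sum_o w o * (\sum_j f (o j)) ^+ 2
                          / (M%:R * eps) ^+ 2)).
    rewrite big_mkcond; apply: ler_sum => o _; case: ifPn => [|_]; last first.
      by apply: mulr_ge0; [apply: mulr_ge0; rewrite ?sqr_ge0 ?w_ge0
                          | rewrite invr_ge0 sqr_ge0].
    rewrite -ltNge estE normrM normfV (gtr0_norm M0') ltr_pdivlMr // => bo.
    rewrite -mulrA ler_peMr // ler_pdivlMr ?exprn_gt0 ?mulr_gt0 // mul1r.
    rewrite -[X in _ <= X]real_normK ?num_real // ler_sqr ?nnegrE //.
      by rewrite mulrC ltW.
    by rewrite mulr_ge0 // ltW.
  rewrite -mulr_suml (sum_outcomes_sqr _ p1 f0 f2).
  rewrite exprMn invfM [X in _ <= X]invfM mulrA ler_wpM2r ?invr_ge0 ?sqr_ge0 //.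
  rewrite ler_pdivrMr ?exprn_gt0 // expr2 mulrA mulVf ?mul1r ?gt_eqF //.
  (* A single outcome has variance 1 - mu^2, which is at most 1. *)
  by have := sqr_ge0 mu; nra.
rewrite lerBlDr -[X in X <= _]w1 (bigID good) /=.
by apply: lerD; [exact: lexx|exact: bad].
Qed.

End SwapTest.

(** * Growth rates *)

Section Growth.
Variable R : realType.
Implicit Types f g : nat -> R.

Lemma bigO_natP f g :
  f =O_\oo g <-> exists2 c : R, 0 < c & \forall n \near \oo, `|f n| <= c * `|g n|.
Proof. exact: eqO_exP. Qed.

Lemma poly_boundedP f : poly_bounded f <->
  exists (k : nat) (c : R), 0 < c /\ \forall n \near \oo, `|f n| <= c * n%:R ^+ k.
Proof.
split=> [[k /bigO_natP[c c0 fc]]|[k [c [c0 fc]]]].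
  exists k, c; split=> //; apply: filterS fc => n.
  by rewrite normrX normr_nat.
exists k; apply/bigO_natP; exists c => //; apply: filterS fc => n.
by rewrite normrX normr_nat.
Qed.

Lemma inv_polyP f : inv_poly f <->
  exists (k : nat) (c : R), 0 < c /\ \forall n \near \oo, c * n%:R ^- k <= `|f n|.
Proof.
have nV k n : `|n%:R ^- k : R| = n%:R ^- k by rewrite ger0_norm // invr_ge0 exprn_ge0.
split=> [[k]|[k [c [c0 fc]]]].
  rewrite qualifE => /asboolP[c c0 fc]; exists k, c; split=> //.
  by apply: filterS fc => n; rewrite nV.
exists k; rewrite qualifE; apply/asboolP; exists c => //.
by apply: filterS fc => n; rewrite nV.
Qed.

Lemma poly_bounded_le f g : (forall n, `|f n| <= `|g n|) ->
  poly_bounded g -> poly_bounded f.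
Proof.
move=> fg /poly_boundedP[k [c [c0 gc]]]; apply/poly_boundedP; exists k, c.
by split=> //; apply: filterS gc => n; apply: le_trans.
Qed.

Lemma poly_boundedD f g :
  poly_bounded f -> poly_bounded g -> poly_bounded (fun n => f n + g n).
Proof.
move=> /poly_boundedP[k [c [c0 fc]]] /poly_boundedP[l [d [d0 gd]]].
apply/poly_boundedP; exists (k + l)%N, (c + d); split; first exact: addr_gt0.
near=> n; have n1 : 1 <= n%:R :> R by rewrite ler1n; near: n; exact: nbhs_infty_ge.
apply: le_trans (ler_normD _ _) _; rewrite mulrDl exprD; apply: lerD.
  apply: (@le_trans _ _ (c * n%:R ^+ k)); first by near: n.
  by rewrite ler_pM2l // ler_peMr ?exprn_ge0 // exprn_ege1.
apply: (@le_trans _ _ (d * n%:R ^+ l)); first by near: n.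
by rewrite ler_pM2l // ler_peMl ?exprn_ge0 // exprn_ege1.
Unshelve. all: by end_near. Qed.

Lemma poly_boundedM f g :
  poly_bounded f -> poly_bounded g -> poly_bounded (fun n => f n * g n).
Proof.
move=> /poly_boundedP[k [c [c0 fc]]] /poly_boundedP[l [d [d0 gd]]].
apply/poly_boundedP; exists (k + l)%N, (c * d); split; first exact: mulr_gt0.
near=> n; rewrite normrM exprD mulrACA; apply: ler_pM => //.
  by near: n.
by near: n.
Unshelve. all: by end_near. Qed.

Lemma poly_boundedX f k : poly_bounded f -> poly_bounded (fun n => f n ^+ k).
Proof.
move=> pf; elim: k => [|k IH].
  apply/poly_boundedP; exists 0%N, 1; split=> //; apply: filterE => n.
  by rewrite !expr0 normr1 mulr1.
by apply: poly_bounded_le (poly_boundedM pf IH) => n; rewrite exprS.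
Qed.

Lemma poly_bounded_cst (c : R) : poly_bounded (fun=> c).
Proof.
apply/poly_boundedP; exists 0%N, (`|c| + 1); split; first by rewrite ltr_wpDl.
by apply: filterE => n; rewrite expr0 mulr1 lerDl.
Qed.

Lemma poly_bounded_nat : poly_bounded (fun n => n%:R : R).
Proof.
apply/poly_boundedP; exists 1%N, 1; split=> //; apply: filterE => n.
by rewrite expr1 mul1r normr_nat.
Qed.

Lemma inv_poly_le f g : (forall n, `|f n| <= `|g n|) -> inv_poly f -> inv_poly g.
Proof.
move=> fg /inv_polyP[k [c [c0 fc]]]; apply/inv_polyP; exists k, c.
by split=> //; apply: filterS fc => n /le_trans; apply.
Qed.

Lemma inv_poly_inv f : (forall n, 0 < f n) -> inv_poly f ->
  poly_bounded (fun n => (f n)^-1).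
Proof.
move=> f0 /inv_polyP[k [c [c0 fc]]]; apply/poly_boundedP; exists k, c^-1.
split; first by rewrite invr_gt0.
near=> n; have n0 : 0 < n%:R :> R by rewrite ltr0n; near: n; exact: nbhs_infty_ge.
have : c * n%:R ^- k <= `|f n| by near: n.
rewrite normfV (gtr0_norm (f0 n)) => cf.
rewrite -[n%:R ^+ k]invrK -invfM lef_pV2 ?posrE //.
by rewrite mulr_gt0 // invr_gt0 exprn_gt0.
Unshelve. all: by end_near. Qed.

Lemma log2_ge1 (n : nat) : (2 <= n)%N -> 1 <= log2 (n%:R : R).
Proof.
move=> n2; have l2 : 0 < ln 2 :> R by rewrite ln_gt0 // ltr1n.
rewrite /log2 ler_pdivlMr // mul1r ler_ln ?posrE ?ltr0n ?ler_nat //.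
exact: leq_trans n2.
Qed.

(** With t <= b log2 n and c <= 2^c, one has c^t <= 2^(c t) <= n^(c b). *)
Lemma exp_log_poly_bounded (t : nat -> nat) (c : nat) :
  (fun n => (t n)%:R : R) =O_\oo (fun n => log2 (n%:R : R)) ->
  poly_bounded (fun n => (c ^ t n)%:R : R).
Proof.
move=> /bigO_natP[b b0 tb]; have l2 : 0 < ln 2 :> R by rewrite ln_gt0 // ltr1n.
(* An integer exponent above c b. *)
pose k := (Num.truncn (c%:R * b)).+1.
apply/poly_boundedP; exists k, 1; split=> //.
near=> n; have n2 : (2 <= n)%N by near: n; exact: nbhs_infty_ge.
have n0 : 0 < n%:R :> R by rewrite ltr0n; exact: leq_trans n2.
have tn : (t n)%:R <= b * log2 (n%:R : R).
  have : `|(t n)%:R : R| <= b * `|log2 (n%:R : R)| by near: n.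
  by rewrite normr_nat ger0_norm // (le_trans ler01) // log2_ge1.
rewrite mul1r normr_nat.
apply: (@le_trans _ _ ((2 ^ (c * t n))%:R)).
  rewrite ler_nat expnM; case: (t n) => [|m]; first by rewrite !expn0.
  by rewrite leq_exp2r // ltnW // ltn_expl.
rewrite natrX -[2 in X in X <= _](lnK (_ : 2 \is Num.pos)) ?posrE ?ltr0n //.
rewrite -[n%:R in X in _ <= X](lnK (_ : n%:R \is Num.pos)) ?posrE //.
rewrite -!expRM_natl ler_expR natrM -mulrA.
apply: (@le_trans _ _ (c%:R * (b * log2 (n%:R : R) * ln 2))).
  by rewrite ler_wpM2l // ler_pM2r.
rewrite /log2 -[b * _ * _]mulrA divfK ?gt_eqF // mulrA ler_wpM2r ?ln_ge0 //.
  by rewrite ler1n; exact: ltnW.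
by rewrite ltW // truncnS_gt.
Unshelve. all: by end_near. Qed.

Lemma neglD f g : negl f -> negl g -> negl (fun n => `|f n| + `|g n|).
Proof.
move=> nf ng k; have /bigO_natP[c c0 fc] := nf k.
have /bigO_natP[d d0 gd] := ng k; apply/bigO_natP.
exists (c + d); first exact: addr_gt0.
near=> n; rewrite ger0_norm ?addr_ge0 // mulrDl; apply: lerD.
  by near: n.
by near: n.
Unshelve. all: by end_near. Qed.

Lemma log2M (x y : R) : 0 < x -> 0 < y -> log2 (x * y) = log2 x + log2 y.
Proof. by move=> x0 y0; rewrite /log2 lnM ?posrE // mulrDl. Qed.

Lemma log2_powR (x : R) : log2 (2 `^ x) = x.
Proof.
by rewrite /log2 ln_powR mulfK // gt_eqF // ln_gt0 // ltr1n.
Qed.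

Lemma powR_log2 (x : R) : 0 < x -> 2 `^ (log2 x) = x.
Proof.
move=> x0; have l2 : 0 < ln 2 :> R by rewrite ln_gt0 // ltr1n.
rewrite /powR pnatr_eq0 /= /log2 divfK ?gt_eqF // lnK //.
Qed.

Lemma ler_log2 (x y : R) : 0 < x -> x <= y -> log2 x <= log2 y.
Proof.
move=> x0 xy; rewrite /log2 ler_pM2r ?invr_gt0 ?ln_gt0 ?ltr1n //.
by rewrite ler_ln ?posrE // (lt_le_trans x0).
Qed.

Lemma log2X4 (m : nat) : log2 ((4 ^ m)%:R : R) = 2 * m%:R.
Proof.
rewrite -[RHS]log2_powR; congr log2.
by rewrite -natrM powR_mulrn // natrX exprM -(natrX _ 2 2).
Qed.

(** On the logarithmic scale, f is within a constant of -alpha n, and g exceeds f by at most 2 t =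
    O(log n). *)
Lemma Theta_exp_sandwich (t : nat -> nat) f g (alpha : R) :
  (fun n => (t n)%:R : R) =O_\oo (fun n => log2 (n%:R : R)) ->
  (forall n, 0 < f n) ->
  (forall n, f n <= g n <= (4 ^ t n)%:R * f n) ->
  f \is 'Theta_\oo (fun n => 2 `^ (- (alpha * n%:R))) ->
  exists2 h : nat -> R, h =O_\oo (fun n => log2 (n%:R : R))
    & forall n, g n = 2 `^ (- (alpha * n%:R) + h n).
Proof.
move=> /bigO_natP[b b0 tb] f0 fg.
rewrite qualifE => /asboolP[[c d] /= /andP[c0 d0] fcd].
have g0 n : 0 < g n by apply: lt_le_trans (f0 n) _; case/andP: (fg n).
exists (fun n => log2 (g n) + alpha * n%:R); last first.
  by move=> n; rewrite addrC addrK powR_log2.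
(* The term 2 b comes from log2 (4^t); the logarithms of the two Theta constants are absorbed
   because log2 n >= 1 for n >= 2. *)
apply/bigO_natP; exists (2 * b + `|log2 c| + `|log2 d|).
  by rewrite ltr_wpDr // ltr_wpDr // mulr_gt0.
near=> n; have n2 : (2 <= n)%N by near: n; exact: nbhs_infty_ge.
have l1 := log2_ge1 n2; have l0 := le_trans ler01 l1.
have e0 : 0 < 2 `^ (- (alpha * n%:R)) :> R by rewrite powR_gt0.
have : c * `|2 `^ (- (alpha * n%:R))| <= `|f n| /\
       `|f n| <= d * `|2 `^ (- (alpha * n%:R))| by near: n.
rewrite (gtr0_norm e0) (gtr0_norm (f0 n)) => -[cf fd].
have tn : (t n)%:R <= b * log2 (n%:R : R).
  have : `|(t n)%:R : R| <= b * `|log2 (n%:R : R)| by near: n.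
  by rewrite normr_nat ger0_norm.
have /andP[fgn gfn] := fg n.
have lo : log2 c - alpha * n%:R <= log2 (g n).
  rewrite -[- _]log2_powR -log2M //; apply: ler_log2; first exact: mulr_gt0.
  exact: le_trans cf fgn.
have hi : log2 (g n) <= 2 * (t n)%:R + (log2 d - alpha * n%:R).
  rewrite -[- _]log2_powR -log2M // -log2X4 -log2M ?mulr_gt0 ?ltr0n ?expn_gt0 //.
  apply: ler_log2 => //; apply: le_trans gfn _.
  by rewrite ler_pM2l // ltr0n expn_gt0.
rewrite (ger0_norm l0) !mulrDl.
have c1 : `|log2 c| <= `|log2 c| * log2 (n%:R : R) by rewrite ler_peMr.
have d1 : `|log2 d| <= `|log2 d| * log2 (n%:R : R) by rewrite ler_peMr.
have := ler_norm (- log2 c); rewrite normrN; have := ler_norm (log2 d).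
have := normr_ge0 (log2 c); have := normr_ge0 (log2 d).
have bl : 0 <= b * log2 (n%:R : R) by apply: mulr_ge0 => //; exact: ltW.
by move=> *; rewrite ler_norml; apply/andP; split; lra.
Unshelve. all: by end_near. Qed.

End Growth.

(** * Assembly of the protocol, its query count and the two purity regimes *)

Theorem mainTheorem1 (R : realType)
  (known_completion : clifford_completion R)
  (known_stabilizer : stabilizer_learning R)
  (t : nat -> nat) (E Y : forall n : nat, {set 'I_n})
  (t_log : (fun n => (t n)%:R : R) =O_\oo (fun n => log2 (n%:R : R)))
  (t_le_nF : forall n, (t n <= #|~: E n|)%N)
  (Y_sub_F : forall n, Y n \subset ~: E n)
  (card_Y : forall n, #|Y n| = t n) :
  exists (m : nat -> nat)
         (A : forall n : nat, query_protocol R n (m n) (op R 'I_n * R))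
         (delta : nat -> R) (shots : R -> R -> R -> nat),
    [/\ poly_bounded (fun n => (queries (A n))%:R : R),
        negl delta,
        forall n : nat, wf_protocol (A n) /\
          forall C : op R 'I_n, doped (t n) C ->
            1 - delta n <=
              success (A n) C (fun o =>
                is_W (t n) C (Y n) o.1 /\
                o.2 = purX (E n) (rho C (Y n) o.1))
      & forall C W : forall n : nat, op R 'I_n,
          (forall n, doped (t n) (C n)) ->
          (forall n, is_W (t n) (C n) (Y n) (W n)) ->
          let pX := fun n => purX (E n) (rho (C n) (Y n) (W n)) in
          let psiE := fun n => marg (E n) (psi (C n)) in
          (inv_poly pX ->
             inv_poly (fun n => Pur (psiE n)) /\
             forall eta err : nat -> R,
               (forall n, 0 < eta n) -> (forall n, 0 < err n) ->
               inv_poly eta -> inv_poly err ->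
               poly_bounded (fun n => (shots (eta n) (err n) (pX n))%:R : R) /\
               forall n, 1 - err n <=
                 swap_test_success (psiE n) (shots (eta n) (err n) (pX n))
                   (eta n * Pur (psiE n)))
          /\
          (forall alpha : R, 0 < alpha ->
             pX \is 'Theta_\oo (fun n => 2 `^ (- (alpha * n%:R))) ->
             exists2 g : nat -> R, g =O_\oo (fun n => log2 (n%:R : R))
               & forall n, Pur (psiE n) = 2 `^ (- (alpha * n%:R) + g n))].
Proof.
have [a [b [c [d1 [nd1 completion_at]]]]] := known_completion.
have [k [d2 [pk nd2 learning_at]]] := known_stabilizer.
have t_le_n n : (t n <= n)%N.
  by rewrite (leq_trans (t_le_nF n)) // -[leqRHS]card_ord max_card.
have ex_protocol n : exists m (p : query_protocol R n m (op R 'I_n * R)),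
    [/\ wf_protocol p, (queries p <= a * n.+1 ^ b * c ^ t n + k n)%N
      & forall C, doped (t n) C -> 1 - (`|d1 n| + `|d2 n|) <=
          success p C (fun out => is_W (t n) C (Y n) out.1 /\
                         out.2 = purX (E n) (rho C (Y n) out.1))].
  have [m1 [p1 [wp1 qp1 p1P]]] := completion_at n (t n) (t_le_n n).
  have [M [A [L [kA AP]]]] := learning_at n.
  have [m [p [wp qp pP]]] := learning_protocol (E n) (card_Y n) wp1 p1P kA AP.
  exists m, p; split=> //; apply: leq_trans qp _.
  by rewrite leq_add2r.
pose A n := projT1 (cid (projT2 (cid (ex_protocol n)))).
have AP n := projT2 (cid (projT2 (cid (ex_protocol n)))).
(* The number of shots strictly exceeds 1/(err eta^2 p^2), the Chebyshev requirement for precision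
   eta p and failure probability err. *)
exists _, A, (fun n => `|d1 n| + `|d2 n|),
  (fun eta err p => (Num.truncn ((err * eta ^+ 2 * p ^+ 2)^-1)).+1).
split.
(* The factor c^t is polynomial because t = O(log n). *)
- apply: (@poly_bounded_le _ _ (fun n =>
    a%:R * (n%:R + 1) ^+ b * (c ^ t n)%:R + (k n)%:R)).
    move=> n; have [_ qA _] := AP n; rewrite natr1 -natrX -!natrM -natrD !normr_nat.
    by rewrite ler_nat.
  apply: poly_boundedD => //; apply: poly_boundedM; last first.
    exact: exp_log_poly_bounded.
  apply: poly_boundedM; first exact: poly_bounded_cst.
  apply: poly_boundedX; apply: poly_boundedD; last exact: poly_bounded_cst.
  exact: poly_bounded_nat.
- exact: neglD.
- by move=> n; have [wA _ pA] := AP n.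
move=> C W dC CW pX psiE.
have psi_gt0 n : 0 < Pur (psiE n) by apply: Pur_psi_gt0 (dC n).
have pX_bounds n : (4 ^ t n)%:R^-1 * Pur (psiE n) <= pX n <= Pur (psiE n).
  by rewrite -(card_Y n); apply: purX_bounds (CW n).
have pow_gt0 n : 0 < (4 ^ t n)%:R :> R by rewrite ltr0n expn_gt0.
have pX_gt0 n : 0 < pX n.
  have /andP[+ _] := pX_bounds n; apply: lt_le_trans.
  by rewrite mulr_gt0 ?invr_gt0.
split=> [ipX|alpha alpha0 tX]; last first.
  (* Here f is [pX] and g the purity of psi_E; the lower bound in [pX_bounds] is read as g <= 4^t
     f. *)
  apply: Theta_exp_sandwich t_log pX_gt0 _ tX => n.
  by have /andP[lo ->] := pX_bounds n; rewrite -ler_pdivrMl.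
split.
  apply: inv_poly_le ipX => n; have /andP[_ hi] := pX_bounds n.
  by rewrite !gtr0_norm.
move=> eta err eta0 err0 ieta ierr.
have x_gt0 n : 0 < err n * eta n ^+ 2 * pX n ^+ 2.
  by rewrite !mulr_gt0 ?exprn_gt0.
split.
  apply: (@poly_bounded_le _ _ (fun n =>
    (err n)^-1 * (eta n)^-1 ^+ 2 * (pX n)^-1 ^+ 2 + 1)).
    move=> n; rewrite normr_nat !exprVn -!invfM -natr1.
    have x0 : 0 <= (err n * eta n ^+ 2 * pX n ^+ 2)^-1 by rewrite invr_ge0 ltW.
    rewrite ger0_norm ?addr_ge0 // lerD2r.
    by case/andP: (truncn_itv x0).
  apply: poly_boundedD; last exact: poly_bounded_cst.
  apply: poly_boundedM; last exact/poly_boundedX/inv_poly_inv.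
  apply: poly_boundedM; first exact: inv_poly_inv.
  exact/poly_boundedX/inv_poly_inv.
move=> n; set M := (Num.truncn _).+1.
have eps0 : 0 < eta n * Pur (psiE n) by rewrite mulr_gt0.
have psd_psiE : psd (psiE n) by apply/psd_marg/psd_psi.
have tr_psiE : \tr (psiE n) = 1.
  by rewrite tr_marg (tr_conj _ (doped_unitary (dC n))) tr_ket0.
apply: le_trans (swap_test_chebyshev psd_psiE tr_psiE (ltn0Sn _) eps0).
rewrite lerD2l lerN2.
have M_gt : (err n * eta n ^+ 2 * pX n ^+ 2)^-1 < M%:R by apply: truncnS_gt.
have M0 : 0 < M%:R :> R by rewrite ltr0n.
(* Replacing the unknown purity of psi_E by the smaller, known [pX n] only enlarges the failure
   bound, to the one for which M was chosen. *)
apply: (@le_trans _ _ (M%:R * (eta n * pX n) ^+ 2)^-1).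
  rewrite lef_pV2 ?posrE ?mulr_gt0 ?exprn_gt0 ?mulr_gt0 //.
  have ep0 : 0 < eta n * pX n by rewrite mulr_gt0.
  rewrite ler_pM2l // ler_sqr ?nnegrE; try exact: ltW.
  by rewrite ler_pM2l //; case/andP: (pX_bounds n).
rewrite invf_ple ?posrE ?mulr_gt0 ?exprn_gt0 ?mulr_gt0 //.
rewrite exprMn -ler_pdivrMr ?mulr_gt0 ?exprn_gt0 // -invfM mulrA.
exact: ltW.
Qed.
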